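(* Over $\mathbb{Q}[p_1,p_2,p_3,p_4]$, let $SN(x)$ be the inversion (compositional inverse) of the formal power series $\int_0^x\frac{dt}{\mathcal{R}(t)}$, where $\mathcal{R}(t)=\sqrt{1+p_1t+p_2t^2+p_3t^3+p_4t^4}$. Then $$SN(x+y)=G(SN(x),SN(y)),$$ where $G$ is the explicit series $$G(x,y)=\mu\left(P_1+\sigma P_1+\frac12\nu(x)\nu(y)\frac{P_2-\sigma P_2}{P_3-\sigma P_3}\right)$$ with $\mu,\nu,\sigma,P_1,P_2,P_3$ as defined in the context.
   Context: $p_1,p_2,p_3,p_4$ are polynomial variables and the square root $\mathcal{R}$ has constant term $1$. The series $\mathcal{B}(x)\in\mathbb{Q}[p_1,p_2,p_3,p_4][[x]]$ is the unique formal power series with $\mathcal{B}(0)=1$ such that, with $\mu(x):=x/\mathcal{B}(x)$, one has $\mathcal{B}(x)=\mathcal{R}(\mu(x))/\mu'(x)$. The series $\mu(x)=x/\mathcal{B}(x)$ is thereby defined, and $\nu(x):=\mu^{-1}(x)$ is its compositional inverse. $\sigma$ is the transposition of $x$ and $y$: $(\sigma P)(x,y)=P(y,x)$. The series $P_i=P_i(x,y)$ are $$P_1=\nu(x)\mathcal{R}(y)\nu'(y),$$ $$P_2=-\nu(x)\Big(\nu'(y)\mathcal{R}(y)\big(\mathcal{R}'(y)-\mathcal{R}'(0)\big)+\mathcal{R}^2(y)\nu''(y)\Big),$$ $$P_3=\nu(x)\mathcal{R}(y)\nu'(y).$$ *)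

(* Defs.v *)
(* Formal power series in n variables over a commutative ring.                *)
(*                                                                            *)
(*       {fps R[n]} == R[[X_0, ..., X_(n-1)]]; f m is the coefficient of the  *)
(*                     monomial m : 'X_{1..n} in f                            *)
(*          fpsC c  == the constant series c                                  *)
(*          fpsX i  == the variable X_i                                       *)
(*     fpsderiv i f == the partial derivative of f with respect to X_i        *)
(*       fpsint i f == the antiderivative of f vanishing at X_i = 0           *)
(*        f \So h   == f(h_0, ..., h_(n-1)), for an n-tuple h of series       *)
(*                     without constant term                                  *)

From HB Require Import structures.
From mathcomp Require Import all_boot all_order all_algebra.
From mathcomp Require Import boolp classical_sets.
From mathcomp Require Import mpoly.

Set Implicit Arguments.
Unset Strict Implicit.
Unset Printing Implicit Defensive.

Import GRing.Theory.
Local Open Scope ring_scope.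

Record fps (n : nat) (R : comNzRingType) := Fps { fpscoef :> 'X_{1..n} -> R }.

Arguments fps n%_nat_scope R.

Notation "{ 'fps' R [ n ] }" := (fps n R)
  (at level 0, R at level 2, n at level 2, format "{ 'fps'  R [ n ] }").

Section FpsRing.
Context (n : nat) (R : comNzRingType).
Implicit Types (f g h : {fps R[n]}) (m : 'X_{1..n}) (d : nat).

Lemma fpsP f g : (forall m, f m = g m) -> f = g.
Proof. by case: f g => [f] [g] /= fg; congr Fps; apply: funext. Qed.

HB.instance Definition _ := gen_eqMixin {fps R[n]}.
HB.instance Definition _ := gen_choiceMixin {fps R[n]}.

Definition fps0 : {fps R[n]} := Fps (fun=> 0).
Definition fpsadd f g : {fps R[n]} := Fps (fun m => f m + g m).
Definition fpsopp f : {fps R[n]} := Fps (fun m => - f m).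

Lemma fpsaddA : associative fpsadd.
Proof. by move=> f g h; apply: fpsP => m /=; rewrite addrA. Qed.
Lemma fpsaddC : commutative fpsadd.
Proof. by move=> f g; apply: fpsP => m /=; rewrite addrC. Qed.
Lemma fpsadd0 : left_id fps0 fpsadd.
Proof. by move=> f; apply: fpsP => m /=; rewrite add0r. Qed.
Lemma fpsaddN : left_inverse fps0 fpsopp fpsadd.
Proof. by move=> f; apply: fpsP => m /=; rewrite addNr. Qed.

HB.instance Definition _ :=
  GRing.isZmodule.Build {fps R[n]} fpsaddA fpsaddC fpsadd0 fpsaddN.

Definition fpsC (c : R) : {fps R[n]} := Fps (fun m => if m == 0%MM then c else 0).

Definition fpsX (i : 'I_n) : {fps R[n]} := Fps (fun m => (m == U_(i)%MM)%:R).

Definition fpsmul f g : {fps R[n]} :=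
  Fps (fun m => \sum_(k : 'X_{1..n < (mdeg m).+1, (mdeg m).+1}
                       | m == (k.1 + k.2)%MM) f k.1 * g k.2).

Definition fpstrunc d f : {mpoly R[n]} :=
  \sum_(k : 'X_{1..n < d}) f k *: 'X_[k].

Lemma mcoeff_fpstrunc d f m : (mdeg m < d)%N -> (fpstrunc d f)@_m = f m.
Proof. by move=> lt_md; rewrite mcoeff_mpoly. Qed.

Lemma eq_mcoeffM d (p p' q q' : {mpoly R[n]}) m :
  (mdeg m < d)%N ->
  (forall k, (mdeg k < d)%N -> p@_k = p'@_k) ->
  (forall k, (mdeg k < d)%N -> q@_k = q'@_k) -> (p * q)@_m = (p' * q')@_m.
Proof.
move=> lt_md eq_p eq_q; rewrite !mcoeffM; apply: eq_bigr => -[k l] /= _.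
by rewrite eq_p ?eq_q //; apply: (leq_trans (bmdeg _)).
Qed.

Lemma fpsmul_trunc d f g m : (mdeg m < d)%N ->
  fpsmul f g m = (fpstrunc d f * fpstrunc d g)@_m.
Proof.
move=> lt_md; rewrite mcoeffM /=; apply: eq_bigr => -[k l] /= _.
by rewrite !mcoeff_fpstrunc //; apply: (leq_trans (bmdeg _)).
Qed.

Lemma fpstruncM d f g m : (mdeg m < d)%N ->
  (fpstrunc d (fpsmul f g))@_m = (fpstrunc d f * fpstrunc d g)@_m.
Proof. by move=> lt_md; rewrite mcoeff_fpstrunc // (fpsmul_trunc _ _ lt_md). Qed.

Lemma fpsmulA : associative fpsmul.
Proof.
move=> f g h; apply: fpsP => m; pose d := (mdeg m).+1.
rewrite !(@fpsmul_trunc d) //.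
transitivity (fpstrunc d f * (fpstrunc d g * fpstrunc d h))@_m.
  by apply: (@eq_mcoeffM d) => // k /fpstruncM.
by rewrite mulrA; apply: (@eq_mcoeffM d) => // k /fpstruncM.
Qed.

Lemma fpsmulC : commutative fpsmul.
Proof.
by move=> f g; apply: fpsP => m; rewrite !(@fpsmul_trunc (mdeg m).+1) // mulrC.
Qed.

Lemma fpsmul1 : left_id (fpsC 1) fpsmul.
Proof.
move=> f; apply: fpsP => m; pose d := (mdeg m).+1.
rewrite (@fpsmul_trunc d) // -[RHS](@mcoeff_fpstrunc d) //.
rewrite -[in RHS](mul1r (fpstrunc d f)); apply: (@eq_mcoeffM d) => // k lt_kd.
by rewrite mcoeff_fpstrunc // mcoeff1 /=; case: eqP.
Qed.

Lemma fpsmulDl : left_distributive fpsmul fpsadd.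
Proof.
move=> f g h; apply: fpsP => m /=; rewrite -big_split /=.
by apply: eq_bigr => k _; rewrite mulrDl.
Qed.

Lemma fps1_neq0 : fpsC 1 != fps0.
Proof.
by apply/eqP => /(congr1 (fun f => f 0%MM)) /=; rewrite eqxx; apply/eqP/oner_neq0.
Qed.

HB.instance Definition _ := GRing.Zmodule_isComNzRing.Build {fps R[n]}
  fpsmulA fpsmulC fpsmul1 fpsmulDl fps1_neq0.

Definition fpsunit f : bool := `[< exists g, g * f = 1 >].
Definition fpsinv f : {fps R[n]} :=
  if fpsunit f then xget 0 [set g | g * f = 1] else f.

Lemma fpsmulV : {in fpsunit, left_inverse 1 fpsinv *%R}.
Proof.
move=> f unit_f; have {}unit_f : fpsunit f by [].
by rewrite /fpsinv unit_f; move/asboolP: unit_f => /xgetPex; apply.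
Qed.
Lemma fpsunitP f g : g * f = 1 -> f \in fpsunit.
Proof. by move=> gf1; apply/asboolP; exists g. Qed.
Lemma fpsinv_out : {in [predC fpsunit], fpsinv =1 id}.
Proof. by move=> f /negbTE nunit_f; rewrite /fpsinv (_ : fpsunit f = false). Qed.

HB.instance Definition _ := GRing.ComNzRing_hasMulInverse.Build {fps R[n]}
  fpsmulV fpsunitP fpsinv_out.

Definition fpsderiv (i : 'I_n) f : {fps R[n]} :=
  Fps (fun m => f (m + U_(i))%MM *+ (m i).+1).

(* The exact quotient of f by g: a solution q of q * g = f (unique when g is  *)
(* regular); unlike f / g, the divisor g need not be a unit.                  *)
Definition fpsquo f g : {fps R[n]} := xget 0 [set q | q * g = f].

End FpsRing.

Arguments fpsX {n R} i.
Arguments fpsC {n R} c.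

(* For series h_i without constant term, only the monomials k of f of degree  *)
(* at most mdeg m contribute to the coefficient of m in f(h_0, ..., h_(n-1)), *)
(* so that the infinite sum over all k reduces to the finite sum below.       *)
Definition fpscomp (n l : nat) (R : comNzRingType)
    (f : {fps R[n]}) (h : n.-tuple {fps R[l]}) : {fps R[l]} :=
  Fps (fun m => \sum_(k : 'X_{1..n < (mdeg m).+1})
         f k * (\prod_(i < n) tnth h i ^+ (k : 'X_{1..n}) i) m).

Notation "f \So h" := (fpscomp f h) (at level 50) : ring_scope.

Local Notation K := {mpoly rat[4]}.

Definition fpsint (n : nat) (i : 'I_n) (f : {fps K[n]}) : {fps K[n]} :=
  Fps (fun m => if m i == 0%N then 0
                else ((m i)%:R^-1 : rat) *: f (m - U_(i))%MM).

(* The polynomial variables p_1, ..., p_4 are the indeterminates 'X_0, ...,    *)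
(* 'X_3 of K = Q[p_1, ..., p_4], so that p_i is param i for i = 1, ..., 4.    *)
Definition param (i : nat) : {fps K[1]} := fpsC 'X_(inord i.-1).

Definition ser_t : {fps K[1]} := fpsX ord0.
Definition ser_x : {fps K[2]} := fpsX ord0.
Definition ser_y : {fps K[2]} := fpsX ord_max.

Definition D (f : {fps K[1]}) : {fps K[1]} := fpsderiv ord0 f.

Definition subst1 (l : nat) (f : {fps K[1]}) (g : {fps K[l]}) : {fps K[l]} :=
  f \So [tuple g].
Definition subst2 (l : nat) (f : {fps K[2]}) (g h : {fps K[l]}) : {fps K[l]} :=
  f \So [tuple g; h].

Definition quartic : {fps K[1]} :=
  1 + param 1 * ser_t + param 2 * ser_t ^+ 2
    + param 3 * ser_t ^+ 3 + param 4 * ser_t ^+ 4.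

(* In RR, compinv f (where f = X + ...) and BB, exactly one series has the    *)
(* required property, and xget selects it.                                    *)
Definition RR : {fps K[1]} :=
  xget 0 [set r : {fps K[1]} | r ^+ 2 = quartic /\ r 0%MM = 1].

Definition compinv (f : {fps K[1]}) : {fps K[1]} :=
  xget 0 [set g : {fps K[1]} |
          [/\ g 0%MM = 0, subst1 f g = ser_t & subst1 g f = ser_t]].

Definition BB : {fps K[1]} :=
  xget 0 [set b : {fps K[1]} |
          b 0%MM = 1 /\ b = subst1 RR (ser_t / b) / D (ser_t / b)].

Definition mu : {fps K[1]} := ser_t / BB.

Definition nu : {fps K[1]} := compinv mu.

Definition SN : {fps K[1]} := compinv (fpsint ord0 (1 / RR)).

Definition sigma (P : {fps K[2]}) : {fps K[2]} := subst2 P ser_y ser_x.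

Definition P1 : {fps K[2]} :=
  subst1 nu ser_x * subst1 RR ser_y * subst1 (D nu) ser_y.

Definition P2 : {fps K[2]} :=
  - (subst1 nu ser_x *
      (subst1 (D nu) ser_y * subst1 RR ser_y
         * (subst1 (D RR) ser_y - fpsC (D RR 0%MM))
       + subst1 RR ser_y ^+ 2 * subst1 (D (D nu)) ser_y)).

Definition P3 : {fps K[2]} :=
  subst1 nu ser_x * subst1 RR ser_y * subst1 (D nu) ser_y.

Definition G : {fps K[2]} :=
  subst1 mu (P1 + sigma P1
    + 1 / 2 * subst1 nu ser_x * subst1 nu ser_y
      * fpsquo (P2 - sigma P2) (P3 - sigma P3)).

(* Main.v *)
(* Put E := nu(SN). From B = R(mu)/mu' one gets nu = x R nu', and SN' = R(SN) *)
(* then gives E = SN E'. The claim becomes                                    *)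
(*    E(x+y) = a b' + a' b + (1/2) a b q,    a := E(x), b := E(y),            *)
(* where q (a b' - a' b) = - (a b'' - a'' b) + R'(0) (a b' - a' b). Both sides *)
(* agree at y = 0, and the right-hand side is annihilated by d/dx - d/dy: with *)
(* a = SN(x) a', b = SN(y) b' this is a polynomial identity in SN, SN', SN'' at *)
(* x and y, modulo SN'^2 = 1 + p_1 SN + ... + p_4 SN^4 and its derivative.     *)
(* All the power series that are defined by choice exist because a map on     *)
(* power series that raises the order of differences has a fixed point.       *)

(* The equation defining [BB] amounts to x mu' = mu R(mu), which for the inverse series reads nu = x
   R nu'. As SN' = R(SN), the series E = nu(SN) satisfies E = SN E': formally, 1/SN is its
   logarithmic derivative. At the point (SN(x), SN(y)), [P1] and [P2] become E(x) E'(y) and -E(x)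
   (E''(y) - R'(0) E'(y)). The theorem is thus the image under mu of an addition law for E alone,
   [addition_law_E].

   That law holds by transport. A series killed by d/dx - d/dy depends only on x + y, hence is
   determined by its restriction to y = 0 ([transport_eq0]). At y = 0 the right-hand side is E(x),
   since E(0) = 0 and E'(0) = 1. That it is killed by d/dx - d/dy is pure algebra: the derivatives
   of E = SN E' eliminate E'' and E''', and the rest follows from the quartic equation for SN'^2 and
   its derivative ([addition_law_identity]). This algebra requires multiplication by a factor built
   from 4, SN(x), SN(y) and del = E(x) E'(y) - E'(x) E(y). The factor can be cancelled because SN is
   x times a unit and del is x - y times a unit ([S_lreg], [del_lreg]). The same divisibility,
   [alternating_dvd], makes the quotient in [G] a genuine power series ([fpsquo_swapP]).

   The square root, [BB] and the compositional inverses exist by [fps_contraction], through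
   [sqrt_ex], [quotient_ode_ex] and [compinv_ex]. The laws of composition are those of polynomial
   evaluation, transferred by [fpscompE]. *)
Require Import Defs.
From HB Require Import structures.
From mathcomp Require Import all_boot all_order all_algebra.
From mathcomp Require Import boolp classical_sets.
From mathcomp Require Import mpoly.
From mathcomp Require Import ring.

Set Implicit Arguments.
Unset Strict Implicit.
Unset Printing Implicit Defensive.

Import GRing.Theory.
Local Open Scope ring_scope.

(** * Coefficients, order and derivatives *)

Section FpsTheory.
Context (n : nat) (R : comNzRingType).
Implicit Types (f g h : {fps R[n]}) (m : 'X_{1..n}) (d e : nat).

Lemma fpsDE f g m : (f + g) m = f m + g m. Proof. by []. Qed.
Lemma fpsNE f m : (- f) m = - f m. Proof. by []. Qed.
Lemma fpsBE f g m : (f - g) m = f m - g m. Proof. by []. Qed.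
Lemma fps1E m : (1 : {fps R[n]}) m = (m == 0%MM)%:R.
Proof. by rewrite /GRing.one /=; case: eqP. Qed.

Lemma fps_sumE (I : Type) (r : seq I) (P : pred I) (F : I -> {fps R[n]}) m :
  (\sum_(i <- r | P i) F i) m = \sum_(i <- r | P i) F i m.
Proof. by apply: (big_morph (fun f : {fps R[n]} => f m)). Qed.

Lemma fpsMnE f k m : (f *+ k) m = f m *+ k.
Proof. by elim: k => [|k IHk]; rewrite ?mulr0n // !mulrS fpsDE IHk. Qed.

Lemma fpsME d f g m : (mdeg m < d)%N ->
  (f * g) m = (fpstrunc d f * fpstrunc d g)@_m.
Proof. exact: fpsmul_trunc. Qed.

Lemma eq_fpsM f f' g g' m :
  (forall k, (mdeg k <= mdeg m)%N -> f k = f' k) ->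
  (forall k, (mdeg k <= mdeg m)%N -> g k = g' k) -> (f * g) m = (f' * g') m.
Proof.
by move=> eq_f eq_g; apply: eq_bigr => -[k l] /= _; rewrite eq_f ?eq_g // -ltnS bmdeg.
Qed.

Lemma fpsM0 f g : (f * g) 0%MM = f 0%MM * g 0%MM.
Proof.
by rewrite (@fpsME 1) ?mdeg0 // (rmorphM (mcoeff 0%MM)) /= !mcoeff_fpstrunc ?mdeg0.
Qed.

Lemma fpsCM c f m : (fpsC c * f) m = c * f m.
Proof.
rewrite (@fpsME (mdeg m).+1) // -[f m](@mcoeff_fpstrunc _ _ (mdeg m).+1) // -mcoeffCM.
apply: (@eq_mcoeffM _ _ (mdeg m).+1) => // k lt_k.
by rewrite mcoeff_fpstrunc // mcoeffC /=; case: ifP; rewrite ?mulr1 ?mulr0.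
Qed.

Fact fpsC_is_additive : additive (@fpsC n R).
Proof. by move=> c c'; apply: fpsP => m /=; case: eqP => _; rewrite ?subr0. Qed.
Fact fpsC_is_multiplicative : multiplicative (@fpsC n R).
Proof.
by split=> // c c'; apply: fpsP => m; rewrite fpsCM /=; case: ifP; rewrite ?mulr0.
Qed.
HB.instance Definition _ := GRing.isAdditive.Build R {fps R[n]} (@fpsC n R)
  fpsC_is_additive.
HB.instance Definition _ := GRing.isMultiplicative.Build R {fps R[n]} (@fpsC n R)
  fpsC_is_multiplicative.

Lemma fpsXME i f m :
  (fpsX i * f) m = if m i == 0%N then 0 else f (m - U_(i))%MM.
Proof.
have trX d : (1 < d)%N -> fpstrunc d (fpsX i) = 'X_i :> {mpoly R[n]}.
  move=> lt1d; apply/mpolyP => k; rewrite mcoeffX.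
  have [lt_kd|le_dk] := ltnP (mdeg k) d.
    by rewrite mcoeff_fpstrunc //= eq_sym.
  rewrite (_ : (_ == k) = false); last first.
    by apply/eqP => eq_k; rewrite -eq_k mdeg1 leqNgt lt1d in le_dk.
  rewrite /fpstrunc raddf_sum big1 //= => l _; rewrite mcoeffZ mcoeffX.
  case: (_ =P k) => [eq_lk|]; last by rewrite mulr0.
  by have:= bmdeg l; rewrite eq_lk ltnNge le_dk.
case: eqP => [mi0|/eqP mi_neq0].
  rewrite /GRing.mul /= big1 // => -[k l] /=; move: (bmnm k) (bmnm l) => {}k {}l /eqP eq_m.
  case: eqP => [eq_k|_]; last by rewrite mul0r.
  by move: mi0; rewrite eq_m eq_k mnmDE mnm1E eqxx.
have le_m : (U_(i) <= m)%MM by rewrite lep1mP.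
have eq_m : m = (U_(i) + (m - U_(i)))%MM by rewrite addmC submK.
have [d lt1d lt_md] : exists2 d, (1 < d)%N & (mdeg m < d)%N by exists (mdeg m).+2.
rewrite (fpsME _ _ lt_md) trX // mulrC [in LHS]eq_m mcoeffMX mcoeff_fpstrunc //.
by rewrite (leq_ltn_trans (mdegB _ _)).
Qed.

Lemma fpsX_dvd i f : (forall m, m i = 0%N -> f m = 0) -> exists g, f = fpsX i * g.
Proof.
move=> f0; exists (Fps (fun m => f (m + U_(i))%MM)); apply: fpsP => m.
rewrite fpsXME; case: eqP => [/f0 //|/eqP mi]; congr (f _) => /=.
by rewrite submK // lep1mP.
Qed.

(* f belongs to the d-th power of the ideal of series without constant term. *)
Definition vanish d f := forall m, (mdeg m < d)%N -> f m = 0.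

Lemma vanish_le d e f : (d <= e)%N -> vanish e f -> vanish d f.
Proof. by move=> le_de ef m lt_md; apply: ef; apply: leq_trans le_de. Qed.
Lemma vanish0 f : vanish 0 f. Proof. by []. Qed.
Lemma vanish1 f : f 0%MM = 0 -> vanish 1 f.
Proof. by move=> f0 m; rewrite ltnS leqn0 mdeg_eq0 => /eqP ->. Qed.
Lemma vanishD d f g : vanish d f -> vanish d g -> vanish d (f + g).
Proof. by move=> df dg m lt_md; rewrite fpsDE df ?dg ?addr0. Qed.
Lemma vanishN d f : vanish d f -> vanish d (- f).
Proof. by move=> df m lt_md; rewrite fpsNE df ?oppr0. Qed.
Lemma vanish_sum d (I : Type) (r : seq I) (P : pred I) (F : I -> {fps R[n]}) :
  (forall i, P i -> vanish d (F i)) -> vanish d (\sum_(i <- r | P i) F i).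
Proof. by move=> dF; apply: big_ind => // *; apply: vanishD. Qed.

Lemma vanishM d e f g : vanish d f -> vanish e g -> vanish (d + e) (f * g).
Proof.
move=> df eg m lt_m; rewrite /GRing.mul /= big1 // => -[k l] /=.
move: (bmnm k) (bmnm l) => {}k {}l /eqP eq_m.
have [/df->|le_dk] := ltnP (mdeg k) d; first by rewrite mul0r.
rewrite [g l]eg ?mulr0 //; move: lt_m; rewrite eq_m mdegD.
by rewrite !ltnNge; apply: contra; apply: leq_add.
Qed.

Lemma vanishMl d f g : vanish d g -> vanish d (f * g).
Proof. by move=> dg; rewrite -[d]add0n; apply: vanishM. Qed.

Lemma vanishMr d f g : vanish d f -> vanish d (f * g).
Proof. by rewrite mulrC; apply: vanishMl. Qed.

Lemma vanishX d f : f 0%MM = 0 -> vanish d (f ^+ d).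
Proof.
move=> /vanish1 f1; elim: d => [|d IHd]; first exact: vanish0.
by rewrite exprS -add1n; apply: vanishM.
Qed.

Lemma vanish_eq f g : (forall d, vanish d (f - g)) -> f = g.
Proof.
move=> fg; apply: fpsP => m; apply/eqP; rewrite -subr_eq0; apply/eqP.
exact: (fg (mdeg m).+1).
Qed.

(* Completeness for the adic topology: the iterates of Phi on 0 converge. *)
Lemma fps_contraction (Phi : {fps R[n]} -> {fps R[n]}) :
  (forall d f g, vanish d (f - g) -> vanish d.+1 (Phi f - Phi g)) ->
  exists f, f = Phi f.
Proof.
move=> Phi_contr; pose u k := iter k Phi 0.
have uS k : vanish k (u k.+1 - u k).
  by elim: k => [|k IHk]; [exact: vanish0 | exact: Phi_contr].
have uD k l : vanish k (u (k + l)%N - u k).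
  elim: l => [|l IHl]; first by rewrite addn0 subrr.
  rewrite addnS -(subrK (u (k + l)%N) (u _.+1)) -addrA; apply: vanishD => //.
  by apply: vanish_le (uS _); apply: leq_addr.
pose f := Fps (fun m => u (mdeg m).+1 m).
have uf k : vanish k (f - u k).
  move=> m lt_mk; rewrite fpsBE /= -(subnKC lt_mk).
  rewrite -opprB; apply/eqP; rewrite oppr_eq0; apply/eqP.
  exact: (uD (mdeg m).+1).
exists f; apply: vanish_eq => d; apply: (@vanish_le _ d.+1) => //.
have -> : f - Phi f = (f - u d.+1) - (Phi f - u d.+1) by rewrite opprB addrA subrK.
by apply: vanishD; [exact: uf | apply: vanishN; exact: Phi_contr].
Qed.

(** The inverse is the fixed point of g -> 1 - (f - 1) g, which raises the order of differences
    because f - 1 has no constant term. *)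
Lemma fps_unit f : f 0%MM = 1 -> f \is a GRing.unit.
Proof.
move=> f0; have [|g eq_g] := @fps_contraction (fun g => 1 - (f - 1) * g).
  move=> d g h dgh.
  rewrite (_ : _ - _ = - ((f - 1) * (g - h))); last by ring.
  by apply/vanishN; rewrite -add1n; apply: vanishM => //; apply: vanish1;
     rewrite fpsBE f0 fps1E eqxx subrr.
apply/unitrPr; exists g; rewrite -{1}(subrK 1 f) mulrDl mul1r {2}eq_g; ring.
Qed.

Lemma fpsV0 f : f 0%MM = 1 -> f^-1 0%MM = 1.
Proof.
move=> f0; have /(congr1 (fun f => fpscoef f 0%MM)) := mulrV (fps_unit f0).
by rewrite fpsM0 f0 mul1r fps1E eqxx.
Qed.

Lemma fpsderivM i f g :
  fpsderiv i (f * g) = fpsderiv i f * g + f * fpsderiv i g.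
Proof.
(* A derivative reads coefficients one degree higher, so the truncation must keep degree
   [(mdeg m).+1]. *)
apply: fpsP => m; pose d := (mdeg m).+2; rewrite fpsDE.
have -> : fpsderiv i (f * g) m = (f * g) (m + U_(i))%MM *+ (m i).+1 by [].
have lt_mD k : (mdeg k < (mdeg m).+1 -> mdeg (k + U_(i)) < d)%N.
  by rewrite mdegD mdeg1 addn1.
rewrite (@fpsME d) ?lt_mD // -mcoeff_deriv mderivM mcoeffD.
rewrite !(fpsME _ _ (ltnSn (mdeg m))).
by congr (_ + _); apply: (@eq_mcoeffM _ _ (mdeg m).+1) => // k lt_k;
   rewrite ?mcoeff_deriv !mcoeff_fpstrunc ?lt_mD //=; apply: ltnW.
Qed.

Fact fpsderiv_is_additive i : additive (@fpsderiv n R i).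
Proof. by move=> f g; apply: fpsP => m /=; rewrite mulrnBl. Qed.
HB.instance Definition _ i := GRing.isAdditive.Build {fps R[n]} {fps R[n]}
  (@fpsderiv n R i) (fpsderiv_is_additive i).

Lemma fpsderivD i : {morph @fpsderiv n R i : f g / f + g}. Proof. exact: raddfD. Qed.
Lemma fpsderivN i : {morph @fpsderiv n R i : f / - f}. Proof. exact: raddfN. Qed.

Lemma fpsderivC i c : fpsderiv i (fpsC c) = 0 :> {fps R[n]}.
Proof. by apply: fpsP => m /=; rewrite mnmD_eq0 mnm1_eq0 andbF mul0rn. Qed.

Lemma fpsderivX i j : fpsderiv i (fpsX j) = (i == j)%:R :> {fps R[n]}.
Proof.
apply: fpsP => m /=; have [->|ij] := eqVneq i j.
  rewrite fps1E -{2}[U_(j)%MM]add0m eqm_add2r.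
  by case: eqP => [->|]; rewrite ?mnm0E ?mul0rn.
rewrite (_ : (_ == _) = false) ?mul0rn //; apply/eqP => /mnmP/(_ i).
by rewrite mnmDE !mnm1E eqxx eq_sym (negbTE ij) addn1.
Qed.

End FpsTheory.


(** * Composition *)

Section FpsComp.
Context (R : comNzRingType).

Definition nocst n l (h : n.-tuple {fps R[l]}) := forall i, tnth h i 0%MM = 0.

(* Modulo series of high order, f \So h only depends on a truncation of f, so  *)
(* that its properties reduce to those of polynomial evaluation.              *)
Definition mpoly_at n l (h : n.-tuple {fps R[l]}) (p : {mpoly R[n]}) :=
  mmap (@fpsC l R) (tnth h) p.

HB.instance Definition _ n l h :=
  GRing.RMorphism.copy (@mpoly_at n l h) (mmap (@fpsC l R) (tnth h)).

Lemma vanish_mmap1 n l (h : n.-tuple {fps R[l]}) k :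
  nocst h -> vanish (mdeg k) (mmap1 (tnth h) k).
Proof.
move=> h0; rewrite mdegE /mmap1.
elim/big_rec2: _ => [|i d f _ df]; first exact: vanish0.
by apply: vanishM => //; apply: vanishX.
Qed.

Lemma vanish_mpoly_at n l (h : n.-tuple {fps R[l]}) d (p : {mpoly R[n]}) :
    nocst h -> (forall k, (mdeg k < d)%N -> p@_k = 0) ->
  vanish d (mpoly_at h p).
Proof.
move=> h0 p0; rewrite /mpoly_at /mmap; apply: vanish_sum => k _.
have [/p0->|le_dk] := ltnP (mdeg k) d; first by rewrite raddf0 mul0r.
by apply/vanishMl/(vanish_le le_dk)/vanish_mmap1.
Qed.

(** Monomials of degree above [mdeg m] do not reach the coefficient of [m], so any polynomial with
    the right low coefficients can replace [f]. *)
Lemma fpscompE n l (f : {fps R[n]}) (h : n.-tuple {fps R[l]}) (p : {mpoly R[n]}) m :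
    nocst h -> (forall k, (mdeg k <= mdeg m)%N -> p@_k = f k) ->
  (f \So h) m = mpoly_at h p m.
Proof.
move=> h0 eq_pf; pose d := (mdeg m).+1.
have -> : (f \So h) m = mpoly_at h (fpstrunc d f) m.
  have szf : (msize (fpstrunc d f) <= d)%N.
    apply: (leq_trans (msize_sum _ _ _)); apply/bigmax_leqP => k _.
    by apply: (leq_trans (msizeZ_le _ _)); rewrite msizeX bmdeg.
  rewrite /mpoly_at (mmapE d) // fps_sumE; apply: eq_bigr => k _.
  by rewrite fpsCM mcoeff_fpstrunc // bmdeg.
apply/eqP; rewrite -subr_eq0 -fpsBE -raddfB; apply/eqP.
apply: (vanish_mpoly_at (d := d)) => // k lt_kd.
by rewrite mcoeffB mcoeff_fpstrunc // eq_pf ?subrr.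
Qed.

Lemma eq_fpscomp n l (f f' : {fps R[n]}) (h : n.-tuple {fps R[l]}) m :
  (forall k, (mdeg k <= mdeg m)%N -> f k = f' k) -> (f \So h) m = (f' \So h) m.
Proof. by move=> eq_f; apply: eq_bigr => k _; rewrite eq_f // -ltnS bmdeg. Qed.

Lemma mpoly_ring_ind n (P : {mpoly R[n]} -> Prop) :
    (forall c, P c%:MP) -> (forall i, P 'X_i) ->
    (forall p q, P p -> P q -> P (p + q)) ->
    (forall p q, P p -> P q -> P (p * q)) ->
  forall p, P p.
Proof.
move=> PC PX PD PM; elim/mpolyind => [|c m p _ _ IHp]; first exact: (PC 0).
apply: (PD) => //; rewrite -mul_mpolyC; apply: (PM) => //.
rewrite mpolyXE_id; apply: (big_ind P); [exact: (PC 1) | exact: PM |].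
move=> j _; elim: (m j) => [|k IHk]; first exact: (PC 1).
by rewrite exprS; apply: PM.
Qed.

(* A copy of composition carrying the hypothesis under which it is a morphism. *)
Definition fpscompat n l (h : n.-tuple {fps R[l]}) of nocst h :=
  fun f : {fps R[n]} => f \So h.

Section Morphism.
Context (n l : nat) (h : n.-tuple {fps R[l]}) (h0 : nocst h).

Fact fpscomp_is_additive : additive (fpscompat h0).
Proof.
move=> f g; apply: fpsP => m; rewrite fpsBE /fpscompat /= -sumrB.
by apply: eq_bigr => k _; rewrite mulrBl.
Qed.

Lemma fpscompC c : fpsC c \So h = fpsC c.
Proof.
apply: fpsP => m; rewrite (@fpscompE _ _ _ _ c%:MP) // => [|k _].
  by rewrite /mpoly_at mmapC.
by rewrite mcoeffC /=; case: eqP; rewrite ?mulr1 ?mulr0.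
Qed.

Lemma fpscompX i : fpsX i \So h = tnth h i.
Proof.
apply: fpsP => m; rewrite (@fpscompE _ _ _ _ 'X_i) // => [|k _].
  by rewrite /mpoly_at mmapX mmap1U.
by rewrite mcoeffX /= eq_sym.
Qed.

Fact fpscomp_is_multiplicative : multiplicative (fpscompat h0).
Proof.
split=> [f g|]; last exact: fpscompC.
apply: fpsP => m; pose d := (mdeg m).+1.
rewrite [LHS](@fpscompE _ _ _ _ (fpstrunc d f * fpstrunc d g)) // => [|k le_km].
  rewrite rmorphM; apply: eq_fpsM => k le_km; apply/esym/fpscompE => // i le_ik;
    by rewrite mcoeff_fpstrunc // ltnS (leq_trans le_ik).
by rewrite -(@fpsME _ _ d).
Qed.

HB.instance Definition _ := GRing.isAdditive.Build {fps R[n]} {fps R[l]}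
  (fpscompat h0) fpscomp_is_additive.
HB.instance Definition _ := GRing.isMultiplicative.Build {fps R[n]} {fps R[l]}
  (fpscompat h0) fpscomp_is_multiplicative.

End Morphism.

Lemma fpscomp0 n l (f : {fps R[n]}) (h : n.-tuple {fps R[l]}) :
  nocst h -> (f \So h) 0%MM = f 0%MM.
Proof.
move=> h0; rewrite (@fpscompE _ _ _ _ (f 0%MM)%:MP) // => [|k].
  by rewrite /mpoly_at mmapC /= eqxx.
by rewrite mdeg0 leqn0 mdeg_eq0 => /eqP ->; rewrite mcoeffC eqxx mulr1.
Qed.

Lemma nocst_comp n l l' (g : n.-tuple {fps R[l]}) (h : l.-tuple {fps R[l']}) :
  nocst g -> nocst h -> nocst [tuple tnth g i \So h | i < n].
Proof. by move=> g0 h0 i; rewrite tnth_mktuple fpscomp0. Qed.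

(** When the outer series is a polynomial, this only says that composition with [h] is a ring
    morphism fixing constants; [fpscompE] and [eq_fpscomp] reduce the general case to that one. *)
Lemma fpscompA n l l' (f : {fps R[n]}) (g : n.-tuple {fps R[l]})
    (h : l.-tuple {fps R[l']}) :
    nocst g -> nocst h ->
  (f \So g) \So h = f \So [tuple tnth g i \So h | i < n].
Proof.
move=> g0 h0; apply: fpsP => m; pose p := fpstrunc (mdeg m).+1 f.
have pE k : (mdeg k <= mdeg m)%N -> p@_k = f k by move=> ?; rewrite mcoeff_fpstrunc.
rewrite (fpscompE (nocst_comp g0 h0) pE).
have -> : ((f \So g) \So h) m = (mpoly_at g p \So h) m.
  apply: eq_fpscomp => k le_km; apply: fpscompE => // i le_ik; apply: pE.
  exact: leq_trans le_km.
congr (fpscoef _ m); rewrite -[LHS]/(fpscompat h0 _) /mpoly_at /mmap raddf_sum /=.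
apply: eq_bigr => k _; rewrite rmorphM rmorph_prod /= /fpscompat fpscompC //.
congr (_ * _); apply: eq_bigr => i _; rewrite tnth_mktuple.
exact: (rmorphXn (fpscompat h0)).
Qed.

(** The chain rule is checked on polynomials, where it is stable under sums and products, then
    transferred by truncation. *)
Lemma fpsderiv_comp n l (f : {fps R[n]}) (h : n.-tuple {fps R[l]}) i :
    nocst h ->
  fpsderiv i (f \So h) = \sum_j (fpsderiv j f \So h) * fpsderiv i (tnth h j).
Proof.
move=> h0.
pose good (p : {mpoly R[n]}) := fpsderiv i (mpoly_at h p) =
  \sum_j mpoly_at h p^`M(j) * fpsderiv i (tnth h j).
have goodp p : good p.
  elim/mpoly_ring_ind: p => [c|j|p q|p q]; rewrite /good.
  - rewrite /mpoly_at mmapC fpsderivC big1 // => j _.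
    by rewrite mderivC /mmap msupp0 big_nil mul0r.
  - rewrite /mpoly_at mmapX mmap1U (bigD1 j) //= big1 ?addr0 => [|k k_neq].
      by rewrite mderivX mnm1E eqxx scale1r -{1}[U_(j)%MM]add0m addmK mpolyX0 -mpolyC1
         mmapC mul1r.
    by rewrite mderivX mnm1E eq_sym (negbTE k_neq) scale0r /mmap msupp0 big_nil mul0r.
  - rewrite !raddfD /= => -> ->; rewrite -big_split /=; apply: eq_bigr => j _.
    by rewrite mderivD raddfD mulrDl.
  - rewrite rmorphM fpsderivM => -> ->.
    rewrite mulr_suml mulr_sumr -big_split /=; apply: eq_bigr => j _.
    by rewrite mderivM raddfD /= !rmorphM /=; ring.
apply: fpsP => m; pose d := (mdeg m).+2; pose p := fpstrunc d f.
have -> : fpsderiv i (f \So h) m = fpsderiv i (mpoly_at h p) m.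
  congr (_ *+ _); apply: fpscompE => // k.
  by rewrite mdegD mdeg1 addn1 => le_km; rewrite mcoeff_fpstrunc.
rewrite goodp !fps_sumE; apply: eq_bigr => j _; apply: eq_fpsM => // k le_km.
apply/esym/fpscompE => // k' le_k'k; rewrite mcoeff_deriv mcoeff_fpstrunc //.
by rewrite mdegD mdeg1 addn1 ltnS ltnS (leq_trans le_k'k).
Qed.

Lemma fpscomp_id n (f : {fps R[n]}) : f \So [tuple fpsX i | i < n] = f.
Proof.
have X0 : nocst [tuple fpsX i | i < n].
  by move=> i; rewrite tnth_mktuple /= eq_sym mnm1_eq0.
have XE p : mpoly_at [tuple fpsX i | i < n] p = Fps (fun m => p@_m).
  elim/mpoly_ring_ind: p => [c|i|p q IHp IHq|p q IHp IHq].
  - by rewrite /mpoly_at mmapC; apply: fpsP => m; rewrite /= mcoeffC;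
       case: eqP; rewrite ?mulr1 ?mulr0.
  - by rewrite /mpoly_at mmapX mmap1U tnth_mktuple; apply: fpsP => m;
       rewrite /= mcoeffX eq_sym.
  - by rewrite raddfD /= IHp IHq; apply: fpsP => m; rewrite fpsDE /= mcoeffD.
  - by rewrite rmorphM /= IHp IHq; apply: fpsP => m; rewrite /= mcoeffM.
apply: fpsP => m; rewrite (@fpscompE _ _ _ _ (fpstrunc (mdeg m).+1 f)) //.
  by rewrite XE /= mcoeff_fpstrunc.
by move=> k le_km; rewrite mcoeff_fpstrunc.
Qed.

(** Continuity of composition in its inner series, from the factor u - v of u^k - v^k. It makes the
    map that defines compositional inverses a contraction. *)
Lemma vanish_comp n l d (f : {fps R[n]}) (h h' : n.-tuple {fps R[l]}) :
    nocst h -> nocst h' -> (forall i, vanish d (tnth h i - tnth h' i)) ->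
  vanish d ((f \So h) - (f \So h')).
Proof.
move=> h0 h'0 dh m lt_md; pose p := fpstrunc (mdeg m).+1 f.
have pE k : (mdeg k <= mdeg m)%N -> p@_k = f k by move=> ?; rewrite mcoeff_fpstrunc.
rewrite fpsBE (fpscompE h0 pE) (fpscompE h'0 pE) -fpsBE.
suff: vanish d (mpoly_at h p - mpoly_at h' p) by apply.
rewrite /mpoly_at /mmap -sumrB; apply: vanish_sum => k _.
rewrite -mulrBr; apply: vanishMl; rewrite /mmap1.
elim/big_rec2: _ => [|i f2 f1 _ df]; first by rewrite subrr => ? _.
rewrite (_ : _ - _ = (tnth h i ^+ k i - tnth h' i ^+ k i) * f1
  + tnth h' i ^+ k i * (f1 - f2)); last by ring.
by apply: vanishD; [rewrite subrXX -mulrA; apply: vanishMr | apply: vanishMl].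
Qed.

End FpsComp.

(** * Series in one variable *)

Local Notation comp1 f g := (f \So [tuple g]).
Local Notation comp2 f g h := (f \So [tuple g; h]).
Local Notation d1 f := (fpsderiv ord0 f).
Local Notation X1 := (@fpsX 1 _ ord0).
Local Notation Xx := (@fpsX 2 _ ord0).
Local Notation Xy := (@fpsX 2 _ ord_max).

Section Composition.
Context (R : comNzRingType).

Lemma nocst1 l (g : {fps R[l]}) : g 0%MM = 0 -> nocst [tuple g].
Proof. by move=> g0 i; rewrite (ord1 i). Qed.

Section Subst.
Context (l : nat).
Implicit Types (f : {fps R[1]}) (g h : {fps R[l]}).

Lemma nocst2 g h : g 0%MM = 0 -> h 0%MM = 0 -> nocst [tuple g; h].
Proof. by move=> g0 h0 i; case: (unliftP ord0 i) => [j|] -> //; rewrite (ord1 j). Qed.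

Lemma comp1D g (g0 : g 0%MM = 0) : {morph (fun f : {fps R[1]} => comp1 f g) : f f' / f + f'}.
Proof. exact: (rmorphD (fpscompat (nocst1 g0))). Qed.
Lemma comp1N g (g0 : g 0%MM = 0) : {morph (fun f : {fps R[1]} => comp1 f g) : f / - f}.
Proof. exact: (rmorphN (fpscompat (nocst1 g0))). Qed.
Lemma comp1M g (g0 : g 0%MM = 0) : {morph (fun f : {fps R[1]} => comp1 f g) : f f' / f * f'}.
Proof. exact: (rmorphM (fpscompat (nocst1 g0))). Qed.
Lemma comp1Xn g (g0 : g 0%MM = 0) k : {morph (fun f : {fps R[1]} => comp1 f g) : f / f ^+ k}.
Proof. exact: (rmorphXn (fpscompat (nocst1 g0))). Qed.
Lemma comp1_1 g (g0 : g 0%MM = 0) : comp1 1 g = 1.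
Proof. exact: (rmorph1 (fpscompat (nocst1 g0))). Qed.
Lemma comp1_nat g (g0 : g 0%MM = 0) k : comp1 k%:R g = k%:R.
Proof. exact: (rmorph_nat (fpscompat (nocst1 g0))). Qed.
Lemma comp1V f g : g 0%MM = 0 -> f \is a GRing.unit -> comp1 f^-1 g = (comp1 f g)^-1.
Proof. by move=> g0; apply: (rmorphV (fpscompat (nocst1 g0))). Qed.
Lemma comp1C g c : g 0%MM = 0 -> comp1 (fpsC c) g = fpsC c.
Proof. by move=> g0; apply/fpscompC/nocst1. Qed.
Lemma comp1X g : g 0%MM = 0 -> comp1 X1 g = g.
Proof. by move=> g0; apply: (fpscompX (nocst1 g0)). Qed.
Lemma comp1_0 f g : g 0%MM = 0 -> comp1 f g 0%MM = f 0%MM.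
Proof. by move=> g0; apply/fpscomp0/nocst1. Qed.

Definition comp1E g (g0 : g 0%MM = 0) :=
  (comp1D g0, comp1N g0, comp1M g0, comp1Xn g0, comp1_1 g0, comp1X g0, comp1_nat g0,
   fun c => comp1C c g0).

Lemma fpsderiv_comp1 i f g : g 0%MM = 0 ->
  fpsderiv i (comp1 f g) = comp1 (d1 f) g * fpsderiv i g.
Proof. by move=> /nocst1 g0; rewrite fpsderiv_comp // big_ord1. Qed.

Lemma comp1_So k f (f' : {fps R[k]}) (h : k.-tuple {fps R[l]}) :
  f' 0%MM = 0 -> nocst h -> comp1 f f' \So h = comp1 f (f' \So h).
Proof.
move=> /nocst1 f'0 h0; rewrite (fpscompA _ f'0 h0); congr (f \So _).
by apply: eq_from_tnth => i; rewrite tnth_mktuple (ord1 i) !tnth0.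
Qed.

Lemma comp1A f f' g : f' 0%MM = 0 -> g 0%MM = 0 ->
  comp1 (comp1 f f') g = comp1 f (comp1 f' g).
Proof. by move=> f'0 /nocst1; apply: comp1_So. Qed.

Lemma comp2_comp1 f (f' : {fps R[2]}) g h :
    f' 0%MM = 0 -> g 0%MM = 0 -> h 0%MM = 0 ->
  comp2 (comp1 f f') g h = comp1 f (comp2 f' g h).
Proof. by move=> f'0 g0 h0; apply: comp1_So => //; apply: nocst2. Qed.

Lemma comp2D g h (g0 : g 0%MM = 0) (h0 : h 0%MM = 0) :
  {morph (fun f : {fps R[2]} => comp2 f g h) : f f' / f + f'}.
Proof. exact: (rmorphD (fpscompat (nocst2 g0 h0))). Qed.
Lemma comp2N g h (g0 : g 0%MM = 0) (h0 : h 0%MM = 0) :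
  {morph (fun f : {fps R[2]} => comp2 f g h) : f / - f}.
Proof. exact: (rmorphN (fpscompat (nocst2 g0 h0))). Qed.
Lemma comp2M g h (g0 : g 0%MM = 0) (h0 : h 0%MM = 0) :
  {morph (fun f : {fps R[2]} => comp2 f g h) : f f' / f * f'}.
Proof. exact: (rmorphM (fpscompat (nocst2 g0 h0))). Qed.
Lemma comp2V (f : {fps R[2]}) g h : g 0%MM = 0 -> h 0%MM = 0 -> f \is a GRing.unit ->
  comp2 f^-1 g h = (comp2 f g h)^-1.
Proof. by move=> g0 h0; apply: (rmorphV (fpscompat (nocst2 g0 h0))). Qed.
Lemma comp2_nat g h (g0 : g 0%MM = 0) (h0 : h 0%MM = 0) k : comp2 k%:R g h = k%:R.
Proof. exact: (rmorph_nat (fpscompat (nocst2 g0 h0))). Qed.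
Lemma comp2Xx g h : g 0%MM = 0 -> h 0%MM = 0 -> comp2 Xx g h = g.
Proof. by move=> g0 h0; apply: (fpscompX (nocst2 g0 h0)). Qed.
Lemma comp2Xy g h : g 0%MM = 0 -> h 0%MM = 0 -> comp2 Xy g h = h.
Proof. by move=> g0 h0; apply: (fpscompX (nocst2 g0 h0)). Qed.

Definition comp2E g h (g0 : g 0%MM = 0) (h0 : h 0%MM = 0) :=
  (comp2D g0 h0, comp2N g0 h0, comp2M g0 h0).

End Subst.


Lemma fpsvar0 l i : (fpsX i : {fps R[l]}) 0%MM = 0.
Proof. by rewrite /= eq_sym mnm1_eq0. Qed.

Lemma fpsvarM0 l i (f : {fps R[l]}) : (fpsX i * f) 0%MM = 0.
Proof. by rewrite fpsM0 fpsvar0 mul0r. Qed.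

Lemma vanish_varM l d i (f : {fps R[l]}) : vanish d f -> vanish d.+1 (fpsX i * f).
Proof. exact/(@vanishM _ _ 1)/vanish1/fpsvar0. Qed.

Lemma fpsvar_lreg l i : GRing.lreg (fpsX i : {fps R[l]}).
Proof.
move=> f g eq_fg; apply: fpsP => m.
have := congr1 (fun h : {fps R[l]} => h (m + U_(i))%MM) eq_fg.
by rewrite !fpsXME mnmDE mnm1E eqxx addn1 /= addmK.
Qed.

Section OneVariable.
Implicit Types (f g k r m n b : {fps R[1]}).

Lemma comp1_id f : comp1 f X1 = f.
Proof.
rewrite -[RHS]fpscomp_id; congr (f \So _); apply: eq_from_tnth => i.
by rewrite tnth_mktuple (ord1 i) tnth0.
Qed.

Lemma fpsderivXM0 f : d1 (X1 * f) 0%MM = f 0%MM.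
Proof. by rewrite fpsderivM fpsderivX mul1r fpsDE fpsvarM0 addr0. Qed.

Lemma fpsX1_dvd f : f 0%MM = 0 -> exists2 g, f = X1 * g & g 0%MM = d1 f 0%MM.
Proof.
move=> f0; have [|g fE] := @fpsX_dvd _ _ ord0 f.
  by move=> m m0; rewrite (_ : m = 0%MM) //; apply/mnmP => i; rewrite (ord1 i) m0 mnm0E.
by exists g => //; rewrite fE fpsderivXM0.
Qed.

Lemma compinv_right f : f 0%MM = 0 -> d1 f 0%MM = 1 ->
  exists g, [/\ g 0%MM = 0, d1 g 0%MM = 1 & comp1 f g = X1].
Proof.
(* With f = t + t^2 w, the inverse t k is given by k = 1 - t k^2 w(t k). *)
move=> f0 Df0; have [f1 fE f10] := fpsX1_dvd f0.
have [|w wE _] := @fpsX1_dvd (f1 - 1).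
  by rewrite fpsBE f10 Df0 fps1E eqxx subrr.
have t0 k : (X1 * k) 0%MM = 0 by exact: fpsvarM0.
pose W k := comp1 w (X1 * k).
have [d k k' dk|k kE] := @fps_contraction _ _ (fun k => 1 - X1 * (k ^+ 2 * W k)).
  have -> (u v : {fps R[1]}) : 1 - X1 * (k ^+ 2 * u) - (1 - X1 * (k' ^+ 2 * v))
    = X1 * ((k + k') * v * - (k - k') - k ^+ 2 * (u - v)) by ring.
  apply: vanish_varM.
  apply: vanishD; first by apply/vanishMl/vanishN.
  apply/vanishN/vanishMl/vanish_comp => [||i]; try exact: nocst1.
  by rewrite (ord1 i) !tnth0 -mulrBr; apply: vanishMl.
exists (X1 * k); split; first exact: t0.
  by rewrite fpsderivXM0 kE fpsBE t0 fps1E eqxx subr0.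
rewrite fE -(subrK 1 f1) wE !(comp1E (t0 k)) -/(W k).
transitivity (X1 * (k + X1 * (k ^+ 2 * W k))); first by ring.
by rewrite {1}kE subrK mulr1.
Qed.

(** A right inverse g of f has itself a right inverse h, and f = f(g(h)) = h, so g is two-sided. *)
Lemma compinv_ex f : f 0%MM = 0 -> d1 f 0%MM = 1 ->
  exists g, [/\ g 0%MM = 0, d1 g 0%MM = 1, comp1 f g = X1 & comp1 g f = X1].
Proof.
move=> f0 Df0; have [g [g0 Dg0 fg]] := compinv_right f0 Df0.
have [h [h0 Dh0 gh]] := compinv_right g0 Dg0.
suff eq_fh : f = h by exists g; split; rewrite ?eq_fh // -eq_fh.
by rewrite -[LHS]comp1_id -gh -(comp1A f g0 h0) fg (comp1X h0).
Qed.

Lemma deriv_inverse m n : m 0%MM = 0 -> comp1 n m = X1 -> comp1 (d1 n) m * d1 m = 1.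
Proof. by move=> m0 nm; rewrite -(fpsderiv_comp1 _ n m0) nm fpsderivX. Qed.

(** Substitute m into the equation for n and use n'(m) m' = 1. This direction serves to construct
    [BB]; the converse [inverse_ode'] yields the equation of [nu]. *)
Lemma inverse_ode r m n : m 0%MM = 0 -> comp1 n m = X1 ->
  n = X1 * r * d1 n -> X1 * d1 m = m * comp1 r m.
Proof.
move=> m0 nm nE.
have tE : X1 = m * comp1 r m * comp1 (d1 n) m.
  by rewrite -[LHS]nm {1}nE !(comp1M m0) (comp1X m0).
by rewrite {1}tE -mulrA (deriv_inverse m0 nm) mulr1.
Qed.

Lemma inverse_ode' r m n : n 0%MM = 0 -> m 0%MM = 0 -> comp1 m n = X1 ->
  X1 * d1 m = m * comp1 r m -> n = X1 * r * d1 n.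
Proof.
move=> n0 m0 mn mE; have nE : n * comp1 (d1 m) n = X1 * r.
  rewrite -{1}(comp1X n0) -(comp1M n0) mE (comp1M n0) (comp1A r m0 n0) mn.
  by rewrite comp1_id.
by rewrite -nE -mulrA (deriv_inverse n0 mn) mulr1.
Qed.

Lemma quotient_ode r b m : b 0%MM = 1 -> m = X1 / b -> b = comp1 r m / d1 m ->
  [/\ m 0%MM = 0, d1 m 0%MM = 1 & X1 * d1 m = m * comp1 r m].
Proof.
move=> b0 mE bE; have unitb := fps_unit b0.
have m0 : m 0%MM = 0 by rewrite mE fpsvarM0.
have Dm0 : d1 m 0%MM = 1 by rewrite mE fpsderivXM0 fpsV0.
have unitD : d1 m \is a GRing.unit by apply: fps_unit.
by split=> //; rewrite -(divrK unitb X1) -mE -mulrA {1}bE divrK.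
Qed.

(** * Antiderivatives and existence results over a ring where positive integers are invertible *)

Section Antiderivative.
Context (invn : nat -> R) (invn_natr : forall k : nat, invn k * k.+1%:R = 1).

Definition fpsprim f : {fps R[1]} :=
  Fps (fun m : 'X_{1..1} => if m ord0 == 0%N then 0 else invn (m ord0).-1 * f (m - U_(ord0))%MM).

Lemma fpsprim0 f : fpsprim f 0%MM = 0.
Proof. by rewrite /= mnm0E. Qed.

Lemma deriv_fpsprim f : d1 (fpsprim f) = f.
Proof.
apply: fpsP => m /=; rewrite mnmDE mnm1E eqxx addn1 /= addmK.
by rewrite -mulr_natl mulrA [_%:R * _]mulrC invn_natr mul1r.
Qed.

Lemma vanish_fpsprim d f g : vanish d (f - g) -> vanish d.+1 (fpsprim f - fpsprim g).
Proof.
move=> dfg m lt_md; rewrite fpsBE /=; case: eqP => [_|/eqP m0]; first by rewrite subrr.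
rewrite -mulrBr -fpsBE dfg ?mulr0 //.
rewrite -ltnS; apply: leq_trans lt_md; rewrite ltnS.
have {2}-> : m = (m - U_(ord0) + U_(ord0))%MM by rewrite submK // lep1mP.
by rewrite mdegD mdeg1 addn1.
Qed.

Lemma ode_ex r : r 0%MM = 1 ->
  exists n : {fps R[1]}, [/\ n 0%MM = 0, d1 n 0%MM = 1 & n = X1 * r * d1 n].
Proof.
move=> r0; have unitr := fps_unit r0.
have [|rho rhoE _] := @fpsX1_dvd (r - 1); first by rewrite fpsBE r0 fps1E eqxx subrr.
(* With r = 1 + t rho, the equation for n = t k reads k' r = - k rho. *)
have [d f g dfg|k kE] := @fps_contraction _ _ (fun k => 1 + fpsprim (- (k * rho / r))).
  rewrite opprD addrACA subrr add0r; apply: vanish_fpsprim.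
  by rewrite -opprD -mulrBl -mulrBl; apply/vanishN/vanishMr/vanishMr.
have k0 : k 0%MM = 1 by rewrite kE fpsDE fpsprim0 fps1E eqxx addr0.
have Dk : d1 k * r = - (k * rho).
  by rewrite {1}kE raddfD /= (fpsderivC _ 1) add0r deriv_fpsprim mulNr divrK.
exists (X1 * k); rewrite fpsderivXM0 k0 fpsvarM0; split=> //.
rewrite fpsderivM fpsderivX mul1r -mulrA; congr (_ * _).
rewrite mulrDr mulrCA [r * d1 k]mulrC Dk -{1}(subrK 1 r) rhoE; ring.
Qed.

(** The equation for b is nonlinear, but that of the inverse n of m = t/b is the linear equation n =
    t r n'. Solve for n, invert it to get m = t c, and take b = 1/c. *)
Lemma quotient_ode_ex r : r 0%MM = 1 -> exists b : {fps R[1]},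
  b 0%MM = 1 /\ b = comp1 r (X1 / b) / d1 (X1 / b).
Proof.
move=> r0; have [n [n0 Dn0 nE]] := ode_ex r0.
have [m [m0 Dm0 nm _]] := compinv_ex n0 Dn0.
have [c mE c0] := fpsX1_dvd m0; rewrite Dm0 in c0.
have unitc := fps_unit c0; have unitD := fps_unit Dm0.
exists c^-1; rewrite invrK -mE fpsV0 //; split=> //.
apply: (mulIr unitD); rewrite divrK // -[RHS](mulKr unitc); congr (_ * _).
by apply: (@fpsvar_lreg _ ord0); rewrite /= mulrA -mE; apply: inverse_ode nm nE.
Qed.

(** With f = 1 + t c, the root 1 + t r amounts to r = (c - t r^2)/2, a fixed point of a
    contraction. *)
Lemma sqrt_ex f : f 0%MM = 1 -> exists r : {fps R[1]}, r ^+ 2 = f /\ r 0%MM = 1.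
Proof.
move=> f0; have [|c cE _] := @fpsX1_dvd (f - 1).
  by rewrite fpsBE f0 fps1E eqxx subrr.
pose h : {fps R[1]} := fpsC (invn 1).
have h2 : h * 2 = 1 by rewrite -(rmorph_nat (@fpsC 1 R)) -rmorphM /= invn_natr rmorph1.
have [d u v duv|r rE] := @fps_contraction _ _ (fun r => h * (c - X1 * r ^+ 2)).
  have -> : h * (c - X1 * u ^+ 2) - h * (c - X1 * v ^+ 2)
    = (h * - (u + v)) * (X1 * (u - v)) by ring.
  by apply: vanishMl; apply: vanish_varM.
exists (1 + X1 * r); split; last by rewrite fpsDE fpsvarM0 addr0 fps1E eqxx.
rewrite -[RHS](subrK 1) cE.
transitivity (1 + X1 * ((h * 2) * c) + X1 * (2 * r - (h * 2) * (c - X1 * r ^+ 2)));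
  first by rewrite h2; ring.
rewrite {1}rE; transitivity (1 + X1 * ((h * 2) * c)); first by ring.
by rewrite h2; ring.
Qed.

End Antiderivative.
End OneVariable.

End Composition.

(** * The addition law *)

(* With del = a b' - a' b and nn = a b'' - a'' b, this is the vanishing of      *)
(* del^2 (nn + rho del) + a b del^2 (d/dx - d/dy)(nn / del).                  *)
Lemma addition_law_identity (A : comNzRingType)
    (a a1 a2 a3 s s1 s2 b b1 b2 b3 u u1 u2 : A) (c1 c2 c3 c4 rho : A) :
    a = s * a1 -> a1 = s1 * a1 + s * a2 -> a2 = s2 * a1 + 2 * s1 * a2 + s * a3 ->
    b = u * b1 -> b1 = u1 * b1 + u * b2 -> b2 = u2 * b1 + 2 * u1 * b2 + u * b3 ->
    s1 ^+ 2 = 1 + c1 * s + c2 * s ^+ 2 + c3 * s ^+ 3 + c4 * s ^+ 4 ->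
    2 * s2 = c1 + 2 * c2 * s + 3 * c3 * s ^+ 2 + 4 * c4 * s ^+ 3 ->
    u1 ^+ 2 = 1 + c1 * u + c2 * u ^+ 2 + c3 * u ^+ 3 + c4 * u ^+ 4 ->
    2 * u2 = c1 + 2 * c2 * u + 3 * c3 * u ^+ 2 + 4 * c4 * u ^+ 3 ->
    2 * rho = c1 ->
  let del := a * b1 - a1 * b in let nn := a * b2 - a2 * b in
  2 * (s * u) ^+ 2 * (del ^+ 2 * (nn + rho * del)
    + a * b * (del * (a1 * b2 - a3 * b - a * b3 + a2 * b1)
               - nn * (2 * a1 * b1 - a2 * b - a * b2))) = 0.
Proof.
move=> aE a1E a2E bE b1E b2E s1E s2E u1E u2E rhoE del nn.
(* Multiplied by enough powers of [s] and [u], all higher derivatives of [a] and [b] become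
   multiples of [a1] and [b1]; this avoids any division. *)
have sa2 : s * a2 = a1 * (1 - s1) 
  by transitivity (s1 * a1 + s * a2 - s1 * a1); [ring | rewrite -a1E; ring].
have ub2 : u * b2 = b1 * (1 - u1) 
  by transitivity (u1 * b1 + u * b2 - u1 * b1); [ring | rewrite -b1E; ring].
have sa3 : s ^+ 2 * a3 = a1 * ((1 - s1) * (1 - 2 * s1) - s * s2).
  have sa3 : s * a3 = a2 - s2 * a1 - 2 * s1 * a2 by rewrite {1}a2E; ring.
  transitivity ((s * a2) * (1 - 2 * s1) - s * s2 * a1); last by rewrite sa2; ring.
  by transitivity (s * (s * a3)); [ring | rewrite sa3; ring].
have ub3 : u ^+ 2 * b3 = b1 * ((1 - u1) * (1 - 2 * u1) - u * u2).
  have ub3 : u * b3 = b2 - u2 * b1 - 2 * u1 * b2 by rewrite {1}b2E; ring.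
  transitivity ((u * b2) * (1 - 2 * u1) - u * u2 * b1); last by rewrite ub2; ring.
  by transitivity (u * (u * b3)); [ring | rewrite ub3; ring].
pose n := s ^+ 2 * (1 - u1) - u ^+ 2 * (1 - s1).
pose dd := 2 * s * u - (1 - s1) * u ^+ 2 - (1 - u1) * s ^+ 2.
pose dn := s ^+ 2 * u * (1 - u1) + s * u ^+ 2 * (1 - s1)
  - u ^+ 3 * ((1 - s1) * (1 - 2 * s1) - s * s2)
  - s ^+ 3 * ((1 - u1) * (1 - 2 * u1) - u * u2).
have delE : del = a1 * b1 * (s - u) by rewrite /del aE bE; ring.
have nnE : s * u * nn = a1 * b1 * n.
  transitivity (s ^+ 2 * a1 * (u * b2) - u ^+ 2 * b1 * (s * a2)).
    by rewrite /nn aE bE; ring.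
  by rewrite sa2 ub2 /n; ring.
have ddE : s * u * (2 * a1 * b1 - a2 * b - a * b2) = a1 * b1 * dd.
  transitivity (2 * a1 * b1 * s * u - (s * a2) * u ^+ 2 * b1 - s ^+ 2 * a1 * (u * b2)).
    by rewrite aE bE; ring.
  by rewrite sa2 ub2 /dd; ring.
have dnE : (s * u) ^+ 2 * (a1 * b2 - a3 * b - a * b3 + a2 * b1) = a1 * b1 * dn.
  transitivity (s ^+ 2 * u * a1 * (u * b2) - (s ^+ 2 * a3) * u ^+ 3 * b1
    - s ^+ 3 * a1 * (u ^+ 2 * b3) + s * u ^+ 2 * b1 * (s * a2)).
    by rewrite aE bE; ring.
  by rewrite sa2 sa3 ub2 ub3 /dn; ring.
transitivity (2 * (del ^+ 2 * ((s * u * nn) * (s * u) + rho * del * (s * u) ^+ 2)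
    + a * b * (del * ((s * u) ^+ 2 * (a1 * b2 - a3 * b - a * b3 + a2 * b1))
               - (s * u * nn) * (s * u * (2 * a1 * b1 - a2 * b - a * b2))))).
  by move: (a1 * b2 - a3 * b - a * b3 + a2 * b1) (2 * a1 * b1 - a2 * b - a * b2) => v w; ring.
rewrite nnE ddE dnE delE aE bE.
transitivity ((a1 * b1) ^+ 3 * (s * u)
  * (2 * ((s - u) ^+ 2 * (n + rho * (s - u) * (s * u)) + (s - u) * dn - n * dd))).
  by move: n dd dn {nnE ddE dnE} => n dd dn; ring.
suff -> : 2 * ((s - u) ^+ 2 * (n + rho * (s - u) * (s * u)) + (s - u) * dn - n * dd) = 0
  by rewrite mulr0.
(* The left-hand side is affine in [s1 ^+ 2], [u1 ^+ 2], [s2], [u2] and [rho]: the terms in [s1],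
   [u1] and [s1 * u1] cancel. The cofactors of the five relations are read off from these
   coefficients. *)
transitivity (2 * (u ^+ 4 - 2 * u ^+ 3 * s) * (s1 ^+ 2
      - (1 + c1 * s + c2 * s ^+ 2 + c3 * s ^+ 3 + c4 * s ^+ 4))
  + 2 * (2 * s ^+ 3 * u - s ^+ 4) * (u1 ^+ 2
      - (1 + c1 * u + c2 * u ^+ 2 + c3 * u ^+ 3 + c4 * u ^+ 4))
  + s * u ^+ 3 * (s - u) * (2 * s2
      - (c1 + 2 * c2 * s + 3 * c3 * s ^+ 2 + 4 * c4 * s ^+ 3))
  + s ^+ 3 * u * (s - u) * (2 * u2
      - (c1 + 2 * c2 * u + 3 * c3 * u ^+ 2 + 4 * c4 * u ^+ 3))
  + (s - u) ^+ 3 * s * u * (2 * rho - c1)).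
  by rewrite /n /dd /dn; ring.
by rewrite s1E s2E u1E u2E rhoE; ring.
Qed.

(** Here [dq] stands for the image of [q] under d/dx - d/dy. After multiplication by [del ^+ 2],
    both enter only through [q * del] and its derivative, which are known; what remains is the
    opposite of [addition_law_identity]. *)
Lemma addition_law_pde (A : comNzRingType)
    (a a1 a2 a3 s s1 s2 b b1 b2 b3 u u1 u2 : A) (c1 c2 c3 c4 rho h q dq : A) :
    a = s * a1 -> a1 = s1 * a1 + s * a2 -> a2 = s2 * a1 + 2 * s1 * a2 + s * a3 ->
    b = u * b1 -> b1 = u1 * b1 + u * b2 -> b2 = u2 * b1 + 2 * u1 * b2 + u * b3 ->
    s1 ^+ 2 = 1 + c1 * s + c2 * s ^+ 2 + c3 * s ^+ 3 + c4 * s ^+ 4 ->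
    2 * s2 = c1 + 2 * c2 * s + 3 * c3 * s ^+ 2 + 4 * c4 * s ^+ 3 ->
    u1 ^+ 2 = 1 + c1 * u + c2 * u ^+ 2 + c3 * u ^+ 3 + c4 * u ^+ 4 ->
    2 * u2 = c1 + 2 * c2 * u + 3 * c3 * u ^+ 2 + 4 * c4 * u ^+ 3 ->
    2 * rho = c1 -> 2 * h = 1 ->
  let del := a * b1 - a1 * b in let nn := a * b2 - a2 * b in
  let ddel := 2 * a1 * b1 - a2 * b - a * b2 in
  let dnn := a1 * b2 - a3 * b - a * b3 + a2 * b1 in
    q * del = - nn + rho * del -> dq * del + q * ddel = - dnn + rho * ddel ->
  4 * (s * u) ^+ 2 * del ^+ 2 * (- nn - h * (del * q) + h * (a * b * dq)) = 0.
Proof.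
move=> aE a1E a2E bE b1E b2E s1E s2E u1E u2E rhoE hE del nn ddel dnn qE dqE.
have Z0 := addition_law_identity aE a1E a2E bE b1E b2E s1E s2E u1E u2E rhoE.
cbv zeta in Z0; rewrite -/del -/nn -/ddel -/dnn in Z0; rewrite -[RHS]oppr0 -Z0.
move: del nn ddel dnn qE dqE {Z0} => del nn ddel dnn qE dqE.
transitivity (2 * (s * u) ^+ 2 * (- 2 * del ^+ 2 * nn - (2 * h) * del ^+ 2 * (q * del)
   + (2 * h) * (a * b * del * (dq * del + q * ddel) - a * b * ddel * (q * del)))).
  by ring.
by rewrite hE dqE qE; ring.
Qed.

(** Stated for abstract derivations [dx] and [dy], so that the computation takes place in a plain
    commutative ring. Differentiating the equation of [q] supplies the second hypothesis of
    [addition_law_pde]. *)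
Lemma addition_law_transport (A : comNzRingType) (dx dy : A -> A)
    (a a1 a2 a3 s s1 s2 b b1 b2 b3 u u1 u2 : A) (c1 c2 c3 c4 rho h q : A) :
    {morph dx : x y / x + y} -> {morph dx : x / - x} ->
    (forall x y, dx (x * y) = dx x * y + x * dx y) ->
    {morph dy : x y / x + y} -> {morph dy : x / - x} ->
    (forall x y, dy (x * y) = dy x * y + x * dy y) ->
    [/\ dx a = a1, dx a1 = a2 & dx a2 = a3] ->
    [/\ dy a = 0, dy a1 = 0 & dy a2 = 0] ->
    [/\ dx b = 0, dx b1 = 0 & dx b2 = 0] ->
    [/\ dy b = b1, dy b1 = b2 & dy b2 = b3] ->
    dx rho = 0 -> dy rho = 0 -> dx h = 0 -> dy h = 0 ->
    [/\ a = s * a1, a1 = s1 * a1 + s * a2 & a2 = s2 * a1 + 2 * s1 * a2 + s * a3] ->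
    [/\ b = u * b1, b1 = u1 * b1 + u * b2 & b2 = u2 * b1 + 2 * u1 * b2 + u * b3] ->
    s1 ^+ 2 = 1 + c1 * s + c2 * s ^+ 2 + c3 * s ^+ 3 + c4 * s ^+ 4 /\
    2 * s2 = c1 + 2 * c2 * s + 3 * c3 * s ^+ 2 + 4 * c4 * s ^+ 3 ->
    u1 ^+ 2 = 1 + c1 * u + c2 * u ^+ 2 + c3 * u ^+ 3 + c4 * u ^+ 4 /\
    2 * u2 = c1 + 2 * c2 * u + 3 * c3 * u ^+ 2 + 4 * c4 * u ^+ 3 ->
    2 * rho = c1 -> 2 * h = 1 ->
  let del := a * b1 - a1 * b in
  let F := a * b1 + a1 * b + h * a * b * q in
    q * del = - (a * b2 - a2 * b) + rho * del ->
  4 * (s * u) ^+ 2 * del ^+ 2 * (dx F - dy F) = 0.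
Proof.
move=> dxD dxN dxM dyD dyN dyM [dxa dxa1 dxa2] [dya dya1 dya2].
move=> [dxb dxb1 dxb2] [dyb dyb1 dyb2] dxr dyr dxh dyh.
move=> [aE a1E a2E] [bE b1E b2E] [s1E s2E] [u1E u2E] rhoE hE del F qE.
pose dxE := (dxD, dxN, dxM, dxa, dxa1, dxa2, dxb, dxb1, dxb2, dxr, dxh).
pose dyE := (dyD, dyN, dyM, dya, dya1, dya2, dyb, dyb1, dyb2, dyr, dyh).
pose ddel := 2 * a1 * b1 - a2 * b - a * b2.
pose dnn := a1 * b2 - a3 * b - a * b3 + a2 * b1.
have dxq : dx q * del + q * (a1 * b1 - a2 * b)
    = - (a1 * b2 - a3 * b) + rho * (a1 * b1 - a2 * b).
  transitivity (dx (q * del)); first by rewrite /del !dxE; ring.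
  by rewrite qE /del !dxE; ring.
have dyq : dy q * del + q * (a * b2 - a1 * b1)
    = - (a * b3 - a2 * b1) + rho * (a * b2 - a1 * b1).
  transitivity (dy (q * del)); first by rewrite /del !dyE; ring.
  by rewrite qE /del !dyE; ring.
have dq : (dx q - dy q) * del + q * ddel = - dnn + rho * ddel.
  transitivity ((dx q * del + q * (a1 * b1 - a2 * b))
    - (dy q * del + q * (a * b2 - a1 * b1))); first by rewrite /ddel; ring.
  by rewrite dxq dyq /dnn /ddel; ring.
rewrite -[RHS](addition_law_pde aE a1E a2E bE b1E b2E s1E s2E u1E u2E rhoE hE qE dq).
by congr (_ * _); rewrite /F !dxE !dyE; ring.
Qed.

(** * Series in two variables: divisibility by x - y and by y, and the transport equation *)

Section TwoVariables.
Context (R : comNzRingType).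
Implicit Types (f u v : {fps R[1]}) (g : {fps R[2]}).

Lemma fpsvarXnE l (i : 'I_l) k (m : 'X_{1..l}) :
  (fpsX i ^+ k : {fps R[l]}) m = (m == U_(i) *+ k)%MM%:R.
Proof.
elim: k m => [|k IHk] m; first by rewrite expr0 fps1E mulm0n.
rewrite exprS fpsXME mulmS; case: eqP => [mi0|/eqP mi].
  case: eqP => // mE; move: mi0; rewrite mE mnmDE mnm1E eqxx.
  by [].
have mE : m = (U_(i) + (m - U_(i)))%MM by rewrite addmC submK ?lep1mP.
by rewrite IHk [in RHS]mE eqm_add2l.
Qed.

Lemma comp1_varE l u (i : 'I_l) (m : 'X_{1..l}) :
  comp1 u (fpsX i) m =
  if (m == U_(i) *+ mdeg m)%MM then u (U_(ord0) *+ mdeg m)%MM else 0.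
Proof.
rewrite /fpscomp /=.
have kE (k : 'X_{1..1}) : (\prod_(j < 1) tnth [tuple (fpsX i : {fps R[l]})] j ^+ k j) m
    = (m == U_(i) *+ k ord0)%MM%:R.
  by rewrite big_ord1 tnth0 fpsvarXnE.
under eq_bigr do rewrite kE.
case: eqP => [mE|mE]; last first.
  apply: big1 => k _; case: eqP => [mk|]; last by rewrite mulr0.
  by case: mE; rewrite {2}mk mdegMn mdeg1 mul1n.
have lt_m : (mdeg (U_(ord0) *+ mdeg m : 'X_{1..1})%MM < (mdeg m).+1)%N.
  by rewrite mdegMn mdeg1 mul1n.
rewrite (bigD1 (BMultinom lt_m)) //= big1 ?addr0 => [|k k_neq].
  by rewrite mulmnE mnm1E eqxx mul1n -mE eqxx mulr1.
case: eqP => [mk|]; last by rewrite mulr0.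
case/eqP: k_neq; apply: val_inj => /=; apply/mnmP => j.
by rewrite (ord1 j) mulmnE mnm1E eqxx mul1n {2}mk mdegMn mdeg1 mul1n.
Qed.

Lemma mdeg2 (m : 'X_{1..2}) : mdeg m = (m ord0 + m ord_max)%N.
Proof. by rewrite mdegE big_ord_recl big_ord1; congr (_ + m _)%N; apply: val_inj. Qed.

Lemma eq_mnm2 (m m' : 'X_{1..2}) :
  m ord0 = m' ord0 -> m ord_max = m' ord_max -> m = m'.
Proof.
move=> eq0 eq1; apply/mnmP => i; case: (unliftP ord0 i) => [j|] -> //.
by rewrite (ord1 j) (_ : lift _ _ = ord_max) //; apply: val_inj.
Qed.

Lemma comp1_xE u (m : 'X_{1..2}) :
  comp1 u Xx m = if m ord_max == 0%N then u (U_(ord0) *+ mdeg m)%MM else 0.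
Proof.
rewrite comp1_varE; congr (if _ then _ else _); apply/eqP/eqP => [->|m1].
  by rewrite mulmnE mnm1E.
by apply: eq_mnm2; rewrite mulmnE mnm1E mdeg2 m1 ?addn0 ?mul1n.
Qed.

Lemma comp1_yE u (m : 'X_{1..2}) :
  comp1 u Xy m = if m ord0 == 0%N then u (U_(ord0) *+ mdeg m)%MM else 0.
Proof.
rewrite comp1_varE; congr (if _ then _ else _); apply/eqP/eqP => [->|m1].
  by rewrite mulmnE mnm1E.
by apply: eq_mnm2; rewrite mulmnE mnm1E mdeg2 m1 ?add0n ?mul1n.
Qed.

(** From x^k - y^k = (x - y) (x^(k-1) + ... + y^(k-1)), the quotient has at each monomial of degree
    d the coefficient of degree d + 1 of [u]. *)
Lemma xy_dvd u : exists g, comp1 u Xx - comp1 u Xy = (Xx - Xy) * g.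
Proof.
exists (Fps (fun m => u (U_(ord0) *+ (mdeg m).+1)%MM)); apply: fpsP => m.
have mdegU (i : 'I_2) : m i != 0%N -> (mdeg (m - U_(i))).+1 = mdeg m.
  by move=> mi; have := mdegD (m - U_(i)) U_(i); rewrite submK ?lep1mP // mdeg1 addn1.
rewrite mulrBl !fpsBE !fpsXME comp1_xE comp1_yE /=.
case: (eqVneq (m ord0)) => [m0|m0]; case: (eqVneq (m ord_max)) => [m1|m1];
  by rewrite ?mdegU ?subr0 ?sub0r ?subrr.
Qed.

(** If x g = y g, each coefficient of g equals the one with a unit of exponent moved from y to x,
    and vanishes once y has exponent 0. *)
Lemma xy_lreg : GRing.lreg (Xx - Xy : {fps R[2]}).
Proof.
suff reg0 g : (Xx - Xy) * g = 0 -> g = 0.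
  move=> f g /eqP; rewrite -subr_eq0 -mulrBr => /eqP/reg0/eqP.
  by rewrite subr_eq0 => /eqP.
move=> /eqP; rewrite mulrBl subr_eq0 => /eqP eq_xy; apply: fpsP => m.
elim: (m ord_max) {-2}m (erefl (m ord_max)) => [|k IHk] {}m m1;
  have := congr1 (fun h : {fps R[2]} => h (m + U_(ord0))%MM) eq_xy;
  rewrite !fpsXME !mnmDE !mnm1E m1 addn1 /= addmK ?addn0 => -> //.
by apply: IHk; rewrite mnmBE mnmDE !mnm1E m1 /= addn0 subn1.
Qed.

Lemma deriv_comp1_var (i j : 'I_2) u :
  fpsderiv i (comp1 u (fpsX j)) = if i == j then comp1 (d1 u) (fpsX j) else 0.
Proof.
rewrite fpsderiv_comp1 ?fpsvar0 // fpsderivX.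
by case: (eqVneq i j) => _; rewrite ?mulr1 ?mulr0.
Qed.

(** Write the difference as (u(x) - u(y)) v(y) - (v(x) - v(y)) u(y). Applying d/dx and evaluating at
    the origin shows that the quotient has the Wronskian at 0 as constant term. *)
Lemma alternating_dvd u v : exists2 g,
    comp1 u Xx * comp1 v Xy - comp1 v Xx * comp1 u Xy = (Xx - Xy) * g
  & g 0%MM = d1 u 0%MM * v 0%MM - d1 v 0%MM * u 0%MM.
Proof.
have [gu guE] := xy_dvd u; have [gv gvE] := xy_dvd v.
have [g gE] : exists g,
    comp1 u Xx * comp1 v Xy - comp1 v Xx * comp1 u Xy = (Xx - Xy) * g.
  exists (gu * comp1 v Xy - gv * comp1 u Xy).
  by rewrite mulrBr !mulrA -guE -gvE; ring.
exists g => //; have : comp1 (d1 u) Xx * comp1 v Xy - comp1 (d1 v) Xx * comp1 u Xy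
    = g + (Xx - Xy) * fpsderiv ord0 g.
  have := congr1 (fpsderiv ord0) gE; rewrite !(fpsderivD, fpsderivN, fpsderivM).
  by rewrite !deriv_comp1_var !fpsderivX /= !mulr0 !addr0 subr0 mul1r.
move=> /(congr1 (fun h : {fps R[2]} => h 0%MM)).
rewrite fpsDE !fpsBE !fpsM0 fpsBE !fpsvar0 subrr mul0r addr0 => <-.
by rewrite !comp1_0 ?fpsvar0.
Qed.

(** Substituting (x + y, x) for (x, y) in [xy_dvd] turns the divisor x - y into y. *)
Lemma shift_dvd u : exists g, comp1 u (Xx + Xy) - comp1 u Xx = Xy * g.
Proof.
have [g gE] := xy_dvd u.
have x0 : (Xx : {fps R[2]}) 0%MM = 0 by exact: fpsvar0.
have xy0 : (Xx + Xy : {fps R[2]}) 0%MM = 0 by rewrite fpsDE !fpsvar0 addr0.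
exists (comp2 g (Xx + Xy) Xx).
have := congr1 (fun h : {fps R[2]} => comp2 h (Xx + Xy) Xx) gE.
rewrite /= !(comp2E xy0 x0) !(comp2_comp1 _ _ xy0 x0) ?fpsvar0 //.
by rewrite (comp2Xx xy0 x0) (comp2Xy xy0 x0) => ->; rewrite addrC addKr.
Qed.

Section Transport.
Context (invn : nat -> R) (invn_natr : forall k : nat, invn k * k.+1%:R = 1).

Lemma mulrSn_eq0 (c : R) k : c *+ k.+1 = 0 -> c = 0.
Proof. by move=> ck; rewrite -[c]mul1r -(invn_natr k) -mulrA mulr_natl ck mulr0. Qed.

(** The equation expresses a positive multiple of each coefficient through one of lower exponent in
    y; divisibility by y starts the induction. *)
Lemma transport_eq0 g h : fpsderiv ord0 g = fpsderiv ord_max g -> g = Xy * h -> g = 0.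
Proof.
move=> gder gE; apply: fpsP => m.
elim: (m ord_max) {-2}m (erefl (m ord_max)) => [|k IHk] {}m m1.
  by rewrite gE fpsXME m1.
have le_m : (U_(ord_max) <= m)%MM by rewrite lep1mP m1.
have := congr1 (fun h : {fps R[2]} => h (m - U_(ord_max))%MM) gder.
rewrite /= (submK le_m) [X in X *+ _ = _]IHk.
  by rewrite mul0rn => /esym/mulrSn_eq0.
by rewrite mnmDE mnmBE !mnm1E /= addn0 m1 subn1.
Qed.

End Transport.

End TwoVariables.


(** * The addition law for E = n(S), and its translation back to S *)

Section AdditionLaw.
Context (R : comNzRingType) (invn : nat -> R).
Context (invn_natr : forall k : nat, invn k * k.+1%:R = 1).

Lemma fps_natr_unit l k : (k.+1%:R : {fps R[l]}) \is a GRing.unit.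
Proof.
apply/unitrPr; exists (fpsC (invn k)).
by rewrite -(rmorph_nat (@fpsC l R)) -rmorphM /= mulrC invn_natr rmorph1.
Qed.

Lemma half_fpsC l : 2^-1 = fpsC (invn 1) :> {fps R[l]}.
Proof.
apply: (mulrI (fps_natr_unit l 1)); rewrite mulrV ?fps_natr_unit //.
by rewrite -(rmorph_nat (@fpsC l R)) -rmorphM /= mulrC invn_natr rmorph1.
Qed.

Context (c1 c2 c3 c4 : R) (r S n : {fps R[1]}).
Context (r2 : r ^+ 2 = 1 + fpsC c1 * X1 + fpsC c2 * X1 ^+ 2
                         + fpsC c3 * X1 ^+ 3 + fpsC c4 * X1 ^+ 4).
Context (r0 : r 0%MM = 1) (S0 : S 0%MM = 0) (DS : d1 S = comp1 r S).
Context (n0 : n 0%MM = 0) (Dn0 : d1 n 0%MM = 1) (nE : n = X1 * r * d1 n).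

(** In the application [r], [S], [n] are R, SN, nu. [W] and [V] are the factors in y of [P1] and
    [P2]; composed with [S] they give E' and -(E'' - R'(0) E'). *)
Let E := comp1 n S.
Let W := r * d1 n.
Let rho : {fps R[1]} := fpsC (d1 r 0%MM).
Let V := - (d1 n * r * (d1 r - rho) + r ^+ 2 * d1 (d1 n)).

Lemma deriv_E : d1 E = comp1 W S.
Proof. by rewrite (fpsderiv_comp1 _ _ S0) DS -(comp1M S0) mulrC. Qed.

Lemma E_eq_mulS : E = S * d1 E.
Proof. by rewrite deriv_E /E {1}nE -mulrA (comp1M S0) (comp1X S0). Qed.

Lemma comp_V : comp1 V S = - (d1 (d1 E) - rho * d1 E).
Proof.
rewrite deriv_E (fpsderiv_comp1 _ _ S0) DS /rho -(comp1C (d1 r 0%MM) S0) -!(comp1M S0).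
rewrite -(comp1N S0) -(comp1D S0) -(comp1N S0); congr (_ \So _).
by rewrite /V /W fpsderivM; ring.
Qed.

Lemma deriv_S0 : d1 S 0%MM = 1. Proof. by rewrite DS comp1_0. Qed.

Lemma E_const0 : E 0%MM = 0. Proof. by rewrite comp1_0. Qed.

Lemma deriv_E0 : d1 E 0%MM = 1. Proof. by rewrite deriv_E comp1_0 // fpsM0 r0 Dn0 mulr1. Qed.

Lemma deriv_S_sqr : d1 S ^+ 2 = 1 + fpsC c1 * S + fpsC c2 * S ^+ 2
  + fpsC c3 * S ^+ 3 + fpsC c4 * S ^+ 4.
Proof. by rewrite DS -(comp1Xn S0) r2 !(comp1E S0). Qed.

(** Differentiate the equation for S'^2 and cancel S', a unit. *)
Lemma deriv2_S : 2 * d1 (d1 S) = fpsC c1 + 2 * fpsC c2 * S + 3 * fpsC c3 * S ^+ 2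
  + 4 * fpsC c4 * S ^+ 3.
Proof.
apply: (mulIr (fps_unit deriv_S0)).
transitivity (d1 (d1 S ^+ 2)); first by rewrite expr2 fpsderivM; ring.
rewrite deriv_S_sqr !exprS !expr0 !(fpsderivD, fpsderivM, fpsderivC _ 1, fpsderivC); ring.
Qed.

Lemma rho_c1 : 2 * d1 r 0%MM = c1.
Proof.
have <- : d1 (d1 S) 0%MM = d1 r 0%MM.
  by rewrite {1}DS (fpsderiv_comp1 _ _ S0) fpsM0 comp1_0 // deriv_S0 mulr1.
transitivity ((2 * d1 (d1 S)) 0%MM); first by rewrite fpsM0 fpsMnE fps1E eqxx.
by rewrite deriv2_S !fpsDE !fpsM0 S0 !mulr0 !addr0 /= eqxx.
Qed.

Lemma E_relations (i : 'I_2) : let s k := comp1 k (fpsX i : {fps R[2]}) in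
  [/\ s E = s S * s (d1 E), s (d1 E) = s (d1 S) * s (d1 E) + s S * s (d1 (d1 E))
    & s (d1 (d1 E)) = s (d1 (d1 S)) * s (d1 E) + 2 * s (d1 S) * s (d1 (d1 E))
        + s S * s (d1 (d1 (d1 E)))].
Proof.
have v0 : (fpsX i : {fps R[2]}) 0%MM = 0 by exact: fpsvar0.
have E1 : d1 E = d1 S * d1 E + S * d1 (d1 E) by rewrite -fpsderivM -E_eq_mulS.
split.
- by rewrite -(comp1M v0) -E_eq_mulS.
- by rewrite -!(comp1M v0) -(comp1D v0) -E1.
rewrite -(comp1_nat v0 2) -!(comp1M v0) -!(comp1D v0); congr (_ \So _).
by rewrite {1}E1 fpsderivD !fpsderivM; ring.
Qed.

Lemma S_relations (i : 'I_2) : let s k := comp1 k (fpsX i : {fps R[2]}) in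
  s (d1 S) ^+ 2 = 1 + fpsC c1 * s S + fpsC c2 * s S ^+ 2
    + fpsC c3 * s S ^+ 3 + fpsC c4 * s S ^+ 4 /\
  2 * s (d1 (d1 S)) = fpsC c1 + 2 * fpsC c2 * s S + 3 * fpsC c3 * s S ^+ 2
    + 4 * fpsC c4 * s S ^+ 3.
Proof.
have v0 : (fpsX i : {fps R[2]}) 0%MM = 0 by exact: fpsvar0.
split.
  by rewrite -(comp1Xn v0) deriv_S_sqr !(comp1E v0).
by rewrite -(comp1_nat v0 2) -(comp1M v0) deriv2_S !(comp1E v0).
Qed.

Let a := comp1 E Xx.
Let a1 := comp1 (d1 E) Xx.
Let a2 := comp1 (d1 (d1 E)) Xx.
Let b := comp1 E Xy.
Let b1 := comp1 (d1 E) Xy.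
Let b2 := comp1 (d1 (d1 E)) Xy.
Let del := a * b1 - a1 * b.
Let nn := a * b2 - a2 * b.
Let rho2 : {fps R[2]} := fpsC (d1 r 0%MM).

Lemma S_lreg (i : 'I_2) : GRing.lreg (comp1 S (fpsX i : {fps R[2]})).
Proof.
have v0 : (fpsX i : {fps R[2]}) 0%MM = 0 by exact: fpsvar0.
have [s SE s0] := fpsX1_dvd S0; rewrite deriv_S0 in s0.
rewrite SE (comp1M v0) (comp1X v0); apply: lregM; first exact: fpsvar_lreg.
by apply/mulrI/fps_unit; rewrite comp1_0.
Qed.

(** [del] is x - y times a series whose constant term, the Wronskian of E and E' at 0 up to sign, is
    E'(0)^2 = 1. *)
Lemma del_lreg : GRing.lreg del.
Proof.
have [g delE g0] := alternating_dvd E (d1 E).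
rewrite /del /a /b1 delE; apply: lregM; first exact: xy_lreg.
by apply/mulrI/fps_unit; rewrite g0 E_const0 deriv_E0 mulr0 subr0 mulr1.
Qed.

Lemma deriv_shift i f : fpsderiv i (comp1 f (Xx + Xy)) = comp1 (d1 f) (Xx + Xy) :> {fps R[2]}.
Proof.
rewrite fpsderiv_comp1 ?fpsDE ?fpsvar0 ?addr0 // fpsderivD !fpsderivX.
by case: (unliftP ord0 i) => [j|] ->; rewrite ?(ord1 j) /= ?addr0 ?add0r mulr1.
Qed.

(** Both sides satisfy the transport equation and agree at y = 0. The hypothesis is all that is
    needed of the quotient. *)
Lemma addition_law_E (q : {fps R[2]}) : q * del = - nn + rho2 * del ->
  comp1 E (Xx + Xy) = a * b1 + a1 * b + 2^-1 * a * b * q.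
Proof.
move=> qE; pose h : {fps R[2]} := 2^-1.
have h2 : 2 * h = 1 by rewrite /h divrr // fps_natr_unit.
have y0 : (Xy : {fps R[2]}) 0%MM = 0 by exact: fpsvar0.
pose a3 := comp1 (d1 (d1 (d1 E))) Xx; pose b3 := comp1 (d1 (d1 (d1 E))) Xy.
have dxx f : fpsderiv ord0 (comp1 f Xx) = comp1 (d1 f) Xx :> {fps R[2]}.
  exact: deriv_comp1_var.
have dyx f : fpsderiv ord_max (comp1 f Xx) = 0 :> {fps R[2]}.
  exact: deriv_comp1_var.
have dxy f : fpsderiv ord0 (comp1 f Xy) = 0 :> {fps R[2]}.
  exact: deriv_comp1_var.
have dyy f : fpsderiv ord_max (comp1 f Xy) = comp1 (d1 f) Xy :> {fps R[2]}.
  exact: deriv_comp1_var.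
have rho2E : 2 * rho2 = fpsC c1 by rewrite -rho_c1 rmorphM rmorph_nat.
have dh i : fpsderiv i h = 0 by rewrite /h half_fpsC fpsderivC.
have := addition_law_transport (fpsderivD ord0) (fpsderivN ord0) (fpsderivM ord0)
  (fpsderivD ord_max) (fpsderivN ord_max) (fpsderivM ord_max)
  (And3 (dxx E) (dxx _) (dxx _)) (And3 (dyx _) (dyx _) (dyx _))
  (And3 (dxy E) (dxy _) (dxy _)) (And3 (dyy _) (dyy _) (dyy _))
  (fpsderivC ord0 _) (fpsderivC ord_max _) (dh _) (dh _)
  (E_relations ord0) (E_relations ord_max)
  (S_relations ord0) (S_relations ord_max) rho2E h2 qE.
have reg : GRing.lreg (4 * (comp1 S Xx * comp1 S Xy) ^+ 2 * del ^+ 2).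
  apply: lregM; last by apply: lregX; apply: del_lreg.
  apply: lregM; first by apply/mulrI/fps_natr_unit.
  by apply: lregX; apply: lregM; apply: S_lreg.
rewrite -[RHS](mulr0 (4 * (comp1 S Xx * comp1 S Xy) ^+ 2 * del ^+ 2)) => /reg.
rewrite -/a -/a1 -/b -/b1 /= => /eqP; rewrite subr_eq0 => /eqP dF.
(* Agreement at y = 0 is made explicit: E(x+y) - E(x), E(y) and E'(y) - 1 are multiples of y. *)
have [gE gEE] := shift_dvd E.
have [e EE _] := fpsX1_dvd E_const0.
have [|e1 E1E _] := @fpsX1_dvd _ (d1 E - 1); first by rewrite fpsBE deriv_E0 fps1E eqxx subrr.
have bE : b = Xy * comp1 e Xy.
  by transitivity (comp1 (X1 * e) Xy); [rewrite -EE | rewrite (comp1M y0) (comp1X y0)].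
have b1E : b1 - 1 = Xy * comp1 e1 Xy.
  have -> : b1 - 1 = comp1 (d1 E - 1) Xy.
    by rewrite (comp1D y0) (comp1N y0) (comp1_1 y0).
  by rewrite E1E (comp1M y0) (comp1X y0).
apply/eqP; rewrite -subr_eq0; apply/eqP.
apply: (transport_eq0 invn_natr (h := gE - (a * comp1 e1 Xy + a1 * comp1 e Xy
  + h * a * comp1 e Xy * q))).
  by rewrite !(fpsderivD _ (comp1 E _)) !fpsderivN !deriv_shift dF.
transitivity ((comp1 E (Xx + Xy) - a) - (a * (b1 - 1) + a1 * b + h * a * b * q)).
  move: a a1 b b1 (comp1 E _) => x x1 y y1 z; rewrite -/h; ring.
rewrite gEE b1E bE.
move: a a1 (comp1 e _) (comp1 e1 _) => x x1 y y1; ring.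
Qed.

Lemma comp2_swap f (i : 'I_2) :
  comp2 (comp1 f (fpsX i)) Xy Xx = comp1 f (if i == ord0 then Xy else Xx) :> {fps R[2]}.
Proof.
have v0 j : (fpsX j : {fps R[2]}) 0%MM = 0 by exact: fpsvar0.
rewrite comp2_comp1 //; case: (unliftP ord0 i) => [j|] ->; last by rewrite (comp2Xx (v0 _)).
by rewrite (ord1 j) (_ : lift _ _ = ord_max) ?(comp2Xy (v0 _)) //; apply: val_inj.
Qed.

Lemma comp2_transport f (i : 'I_2) :
  comp2 (comp1 f (fpsX i)) (comp1 S Xx) (comp1 S Xy) = comp1 (comp1 f S) (fpsX i).
Proof.
have v0 j : (fpsX j : {fps R[2]}) 0%MM = 0 by exact: fpsvar0.
have s0 j : comp1 S (fpsX j : {fps R[2]}) 0%MM = 0 by rewrite comp1_0.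
rewrite comp2_comp1 // (comp1A _ S0 (v0 i)); case: (unliftP ord0 i) => [j|] ->.
  by rewrite (ord1 j) (_ : lift _ _ = ord_max) ?(comp2Xy (s0 _)) //; apply: val_inj.
by rewrite (comp2Xx (s0 _)).
Qed.

Context (m : {fps R[1]}) (mn : comp1 m n = X1).

Let P1 : {fps R[2]} := comp1 n Xx * comp1 r Xy * comp1 (d1 n) Xy.
Let P2 : {fps R[2]} := - (comp1 n Xx *
  (comp1 (d1 n) Xy * comp1 r Xy * (comp1 (d1 r) Xy - fpsC (d1 r 0%MM))
   + comp1 r Xy ^+ 2 * comp1 (d1 (d1 n)) Xy)).
Let swap (P : {fps R[2]}) := comp2 P Xy Xx.

Let x0 : (Xx : {fps R[2]}) 0%MM = 0. Proof. exact: fpsvar0. Qed.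
Let y0 : (Xy : {fps R[2]}) 0%MM = 0. Proof. exact: fpsvar0. Qed.

Lemma P1E : P1 = comp1 n Xx * comp1 W Xy.
Proof. by rewrite /P1 -mulrA -(comp1M y0). Qed.

Lemma swapP1E : swap P1 = comp1 W Xx * comp1 n Xy.
Proof. by rewrite P1E /swap (comp2M y0 x0) !comp2_swap mulrC. Qed.

Lemma P2E : P2 = comp1 n Xx * comp1 V Xy.
Proof. by rewrite /P2 /V -mulrN; congr (_ * _); rewrite !(comp1E y0). Qed.

Lemma swapP2E : swap P2 = comp1 V Xx * comp1 n Xy.
Proof. by rewrite P2E /swap (comp2M y0 x0) !comp2_swap mulrC. Qed.

(** The divisor is not a unit, but both differences are alternating, hence multiples of x - y, and
    the cofactor of the divisor has constant term n'(0) W(0) = 1. *)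
Lemma fpsquo_swapP : fpsquo (P2 - swap P2) (P1 - swap P1) * (P1 - swap P1) = P2 - swap P2.
Proof.
have [g gE g0] := alternating_dvd n W; have [g' g'E _] := alternating_dvd n V.
have g_unit : g \is a GRing.unit.
  by apply: fps_unit; rewrite g0 n0 Dn0 fpsM0 r0 Dn0 !mul1r mulr0 subr0.
have ex_q : exists q, q * (P1 - swap P1) = P2 - swap P2.
  exists (g' / g); rewrite swapP1E swapP2E P1E P2E gE g'E.
  by rewrite mulrCA divrK.
exact: (xgetPex 0 ex_q).
Qed.

Theorem addition_law : comp1 S (Xx + Xy) =
  comp2 (comp1 m (P1 + swap P1 + 1 / 2 * comp1 n Xx * comp1 n Xy
    * fpsquo (P2 - swap P2) (P1 - swap P1))) (comp1 S Xx) (comp1 S Xy).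
Proof.
have sx0 : comp1 S (Xx : {fps R[2]}) 0%MM = 0 by rewrite comp1_0.
have sy0 : comp1 S (Xy : {fps R[2]}) 0%MM = 0 by rewrite comp1_0.
have xy0 : (Xx + Xy : {fps R[2]}) 0%MM = 0 by rewrite fpsDE x0 y0 addr0.
have sxy0 : comp1 S (Xx + Xy : {fps R[2]}) 0%MM = 0 by rewrite comp1_0.
have := fpsquo_swapP; move: (fpsquo _ _) => q; rewrite swapP1E swapP2E P1E P2E => qE.
(* Substituting (S(x), S(y)) turns the equation of the quotient into the hypothesis of
   [addition_law_E]. *)
have {}qE : comp2 q (comp1 S Xx) (comp1 S Xy) * del = - nn + rho2 * del.
  have := congr1 (fun f : {fps R[2]} => comp2 f (comp1 S Xx) (comp1 S Xy)) qE.
  rewrite /= !(comp2D sx0 sy0, comp2N sx0 sy0, comp2M sx0 sy0) !comp2_transport.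
  rewrite -!deriv_E !comp_V -/E => ->.
  rewrite !(comp1D x0, comp1N x0, comp1M x0, comp1D y0, comp1N y0, comp1M y0).
  rewrite !(comp1C _ x0) !(comp1C _ y0) /nn /del /rho2 -/a -/a1 -/a2 -/b -/b1 -/b2.
  move: a a1 a2 b b1 b2 (fpsC _) => x x1 x2 y y1 y2 c; ring.
rewrite comp2_comp1 //; last first.
  by rewrite fpsDE fpsDE !fpsM0 !comp1_0 // n0 !(mul0r, mulr0) !addr0.
rewrite !(comp2D sx0 sy0, comp2M sx0 sy0) !comp2_transport.
rewrite (comp2V sx0 sy0) ?fps_natr_unit // (comp2_nat sx0 sy0) (comp2_nat sx0 sy0 1).
rewrite mul1r -/E -deriv_E -(addition_law_E qE) /E.
(* Since m(n) = t, applying [m] to E(x+y) = n(S(x+y)) gives S(x+y). *)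
by rewrite (comp1A _ S0 xy0) -(comp1A _ n0 sxy0) mn (comp1X sxy0).
Qed.

End AdditionLaw.


(** * The series of the statement *)

Local Notation K := {mpoly rat[4]}.

Definition invK (k : nat) : K := (k.+1%:R^-1)%:MP.

Lemma invK_natr k : invK k * k.+1%:R = 1.
Proof.
rewrite -(rmorph_nat (@mpolyC 4 rat)) -mpolyCM mulVf ?mpolyC1 //.
by rewrite Num.Theory.pnatr_eq0.
Qed.

Lemma quartic0 : quartic 0%MM = 1.
Proof.
rewrite /quartic /ser_t !fpsDE !fpsM0 !fpsvar0 !(mul0r, mulr0) !addr0.
by rewrite fps1E eqxx.
Qed.

Lemma RR_spec : RR ^+ 2 = quartic /\ RR 0%MM = 1.
Proof. exact: (xgetPex 0 (sqrt_ex invK_natr quartic0)). Qed.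

Lemma compinv_spec (f : {fps K[1]}) : f 0%MM = 0 -> D f 0%MM = 1 ->
  compinv f 0%MM = 0 /\ subst1 f (compinv f) = ser_t.
Proof.
move=> f0 Df0.
have ex_g : exists g : {fps K[1]},
    [/\ g 0%MM = 0, subst1 f g = ser_t & subst1 g f = ser_t].
  by have [g [g0 _ fg gf]] := compinv_ex f0 Df0; exists g; split;
    [exact: g0 | exact: fg | exact: gf].
by case: (xgetPex 0 ex_g) => g0 fg _; split; [exact: g0 | exact: fg].
Qed.

Lemma mu_spec : [/\ mu 0%MM = 0, D mu 0%MM = 1 & ser_t * D mu = mu * subst1 RR mu].
Proof.
have [BB0 BBE] : BB 0%MM = 1 /\ BB = subst1 RR mu / D mu.
  exact: (xgetPex 0 (quotient_ode_ex invK_natr RR_spec.2)).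
exact: (quotient_ode BB0 erefl BBE).
Qed.

Lemma nu_spec :
  [/\ nu 0%MM = 0, D nu 0%MM = 1, subst1 mu nu = ser_t & nu = ser_t * RR * D nu].
Proof.
have [mu0 Dmu0 muE] := mu_spec; have [nu0 mu_nu] := compinv_spec mu0 Dmu0.
split; [exact: nu0 | | exact: mu_nu | exact: inverse_ode' nu0 mu0 mu_nu muE].
have /(congr1 (fun f : {fps K[1]} => f 0%MM)) := deriv_inverse nu0 mu_nu.
by rewrite fpsM0 comp1_0 // Dmu0 mul1r fps1E eqxx.
Qed.

(** Differentiating the identity that inverts the integral of 1/R gives SN' / R(SN) = 1. *)
Lemma SN_spec : SN 0%MM = 0 /\ D SN = subst1 RR SN.
Proof.
have [_ RR0] := RR_spec; have RR_unit := fps_unit RR0.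
have int0 f : fpsint ord0 f 0%MM = 0 by rewrite /= mnm0E.
have D_int (f : {fps K[1]}) : D (fpsint ord0 f) = f.
  apply: fpsP => m /=; rewrite mnmDE mnm1E eqxx addn1 /= addmK.
  by rewrite scalerMnl -mulr_natr mulVf ?scale1r // Num.Theory.pnatr_eq0.
have [SN0 SNE] : SN 0%MM = 0 /\ subst1 (fpsint ord0 (1 / RR)) SN = ser_t.
  by apply: compinv_spec; rewrite ?int0 // D_int mul1r fpsV0.
split; first exact: SN0.
have := deriv_inverse SN0 SNE; rewrite -[fpsderiv _ (fpsint _ _)]/(D _) D_int mul1r.
have RRS_unit : subst1 RR SN \is a GRing.unit.
  by apply: fps_unit; rewrite (comp1_0 RR SN0) RR0.
by rewrite (comp1V SN0 RR_unit) => /(congr1 ( *%R (subst1 RR SN))); rewrite (mulVKr RRS_unit) mulr1.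
Qed.

Theorem corollary1p5 :
  subst1 SN (ser_x + ser_y) = subst2 G (subst1 SN ser_x) (subst1 SN ser_y).
Proof.
have [RR2 RR0] := RR_spec; have [SN0 DSN] := SN_spec.
have [nu0 Dnu0 mu_nu nuE] := nu_spec.
(* [P3] has the same body as [P1], so the divisor in [G] is convertible to the one in
   [addition_law]. *)
exact: (addition_law invK_natr RR2 RR0 SN0 DSN nu0 Dnu0 nuE mu_nu).
Qed.
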